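(* For non-negative integers $n,m,k,l$ with $m,k\le n$, $m+k-n\le l\le\min(m,k)$, $m\le n-m$, and $x=0,1,\dots,m$, the sum $s(x\mid q):=\sum_{u=0}^x p(u\mid n,m,k,l\mid q)$ equals \[ s(x\mid q)=\begin{bmatrix}n-k\\ m-l\end{bmatrix}_q\frac{\begin{bmatrix}n\\ x\end{bmatrix}_q}{\begin{bmatrix}n\\ m\end{bmatrix}_q}\;{}_4\phi_3\!\left(\begin{matrix}q^{-x},\ q^{x-n},\ q^{-M},\ q^{-N}\\ q^{-m},\ q^{m-n},\ q^{-M-N}\end{matrix};q,q\right), \] with $M:=m-l$, $N:=n-m-k+l$. Moreover, $s(m\mid q)=1$.
   Context: Let $q$ be a prime power, $\mathcal{V}$ an $n$-dimensional $\mathbb{F}_q$-space with basis $v_1,\dots,v_n$, $\mathcal{V}_i:=\mathrm{span}(v_1,\dots,v_i)$, $\mathcal{V}_k^c:=\mathrm{span}(v_{k+1},\dots,v_n)$. Let $G=\mathrm{GL}(\mathcal{V})$, $K=\{g\in G: g\mathcal{V}_m=\mathcal{V}_m\}$; $\mathrm{Ind}_K^G1=\bigoplus_{x=0}^m\mathcal{V}_x$ multiplicity-free, with $\mathcal{V}_x$ of character $\chi_x$ corresponding to the Schur function $s_{(n-x,x)}$. Let $\mathcal{T}=(\mathbb{C}^2)^{\otimes\mathbb{P}^1(\mathcal{V})}$ with $G$ acting by $\varphi$ permuting lines; $|e_{\mathcal{W}}\rangle$ has factor $|1\rangle$ at lines contained in $\mathcal{W}$ and $|0\rangle$ elsewhere.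 Set $|\Xi_{n,m|k,l|q}\rangle:=\begin{bmatrix}n-k\\ m-l\end{bmatrix}_q^{-1/2}\sum_{\mathcal{W}}|e_{\mathcal{W}}\rangle$ over $\mathcal{W}$ with $\mathcal{V}_l\subset\mathcal{W}$, $\dim\mathcal{W}=m$, $\dim(\mathcal{W}\cap\mathcal{V}_k^c)=m-l$; $\mathsf{P}_{x|q}:=\frac{\dim\mathcal{V}_x}{|G|}\sum_{g}\chi_x(g)\varphi(g)$; $p(x\mid n,m,k,l\mid q):=\langle\Xi_{n,m|k,l|q}|\mathsf{P}_{x|q}|\Xi_{n,m|k,l|q}\rangle$. Notation: $(a;q)_r=\prod_{j=0}^{r-1}(1-aq^j)$, $\begin{bmatrix}n\\ m\end{bmatrix}_q=\frac{(q;q)_n}{(q;q)_m(q;q)_{n-m}}$, ${}_4\phi_3\!\left(\begin{matrix}a_1,\dots,a_4\\ b_1,b_2,b_3\end{matrix};q,z\right)=\sum_{r\ge0}\frac{(a_1,\dots,a_4;q)_r}{(b_1,b_2,b_3,q;q)_r}z^r$. *)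

(* Defs.v *)
From HB Require Import structures.
From mathcomp Require Import all_boot all_order all_algebra all_field.
Set Implicit Arguments. Unset Strict Implicit. Unset Printing Implicit Defensive.
Import GRing.Theory Num.Theory.
Local Open Scope ring_scope.

Definition qpoch (a q : algC) (r : nat) : algC := \prod_(j < r) (1 - a * q ^+ j).

Definition qbinom (q : algC) (N M : nat) : algC :=
  qpoch q q N / (qpoch q q M * qpoch q q (N - M)).

(* terminating 4phi3, summed over r = 0..T (terms beyond the termination
   index vanish; in algC, 0/0 = 0). *)
Definition phi43 (a1 a2 a3 a4 b1 b2 b3 q z : algC) (T : nat) : algC :=
  \sum_(r < T.+1)
    (qpoch a1 q r * qpoch a2 q r * qpoch a3 q r * qpoch a4 q r)
    / (qpoch b1 q r * qpoch b2 q r * qpoch b3 q r * qpoch q q r) * z ^+ r.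

Section Setup.
Variables (F : finFieldType) (n : nat).
Local Notation V := 'rV[F]_n.

Definition span_set r (A : 'M[F]_(r, n)) : {set V} := [set v : V | (v <= A)%MS].

Definition subspaces (d : nat) : {set {set V}} :=
  [set W : {set V} | [exists A : 'M[F]_(d, n), (\rank A == d) && (W == span_set A)]].

Definition Lines : {set {set V}} := subspaces 1.

Definition coordV (i : nat) : {set V} :=
  [set v : V | [forall j : 'I_n, (i <= j)%N ==> (v 0 j == 0)]].
Definition coordVc (k : nat) : {set V} :=
  [set v : V | [forall j : 'I_n, (j < k)%N ==> (v 0 j == 0)]].

Definition GLset : {set 'M[F]_n} := [set g : 'M[F]_n | g \in unitmx].

Definition actS (g : 'M[F]_n) (S : {set V}) : {set V} := [set v *m g | v in S].
Definition actL (g : 'M[F]_n) (X : {set {set V}}) : {set {set V}} :=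
  [set actS g l | l in X].

Definition permchar (d : nat) (g : 'M[F]_n) : algC :=
  #|[set W in subspaces d | actS g W == W]|%:R.

(* chi_x: character of V_x, where Ind_K^G 1 (K = stabilizer of an x-space)
   = V_0 + ... + V_x, i.e. chi_x = pi_x - pi_{x-1} *)
Definition chi (x : nat) (g : 'M[F]_n) : algC :=
  permchar x g - (if x is x'.+1 then permchar x' g else 0).

Definition dimV (x : nat) : algC := chi x 1%:M.

(* vectors of T = (C^2)^{(x) P^1(V)}, indexed by subsets of Lines *)
Definition state := {set {set V}} -> algC.

Definition braket (a b : state) : algC :=
  \sum_(S in powerset Lines) (a S)^* * b S.

(* phi(g) |e_S> = |e_{gS}> *)
Definition phi (g : 'M[F]_n) (psi : state) : state :=
  fun S => psi (actL (invmx g) S).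

Definition Proj (x : nat) (psi : state) : state :=
  fun S => dimV x / #|GLset|%:R * \sum_(g in GLset) chi x g * phi g psi S.

(* |e_W> : |1> at lines contained in W, |0> elsewhere *)
Definition ket (W : {set V}) : state :=
  fun S => (S == [set l in Lines | l \subset W])%:R.

Definition Wset (m k l : nat) : {set {set V}} :=
  [set W in subspaces m |
     (coordV l \subset W) && (W :&: coordVc k \in subspaces (m - l))].

Definition Xi (m k l : nat) : state :=
  fun S => (sqrtC (qbinom #|F|%:R (n - k) (m - l)))^-1 *
           \sum_(W in Wset m k l) ket W S.

Definition pprob (x m k l : nat) : algC := braket (Xi m k l) (Proj x (Xi m k l)).

End Setup.

(* Main.v *)
Require Import Defs.
From mathcomp Require Import all_boot all_order all_algebra all_field.
From mathcomp Require Import fingroup mxabelem zify ring.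
Set Implicit Arguments. Unset Strict Implicit. Unset Printing Implicit Defensive.
Import Order.TTheory GRing.Theory Num.Theory.
Local Open Scope ring_scope.

(* The kernel of P_0 + ... + P_x on the span of the |e_W>, dim W = m, is a
   function E_x of the pair (W, W').  It is found as E_x = A B with A the
   inclusion matrix between x- and m-dimensional subspaces and B an explicit
   left inverse of A: B(U, W) is a combination of the numbers of r-subspaces of
   U meeting W trivially, and B A = 1 is the q-binomial theorem.  Hence
   tr(g E_x) = tr(g B A) is the permutation character on x-subspaces, so by
   Burnside's lemma E_x and P_0 + ... + P_x have the same traces against all
   E_v.  As the E_v span the functions of dim (W cap W'), the two kernels agree.
   Summing E_x over the support of Xi counts again r-subspaces avoiding a given
   subspace, which yields the r-th term of the 4phi3; and E_m is the identity. *)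

(** By definition [chi] is a difference of permutation characters, so what is directly accessible
    about P_u are averages of products of fixed-point counts. Such averages are traces, which is why
    kernels are compared through the pairings of H with E_v, that is, the sums of H(W, W') E_v(W,
    W'). For H = P_u the pairing is dim V_u if u <= v and 0 otherwise; for H = E_x it is the number
    of subspaces of dimension min(x, v). Summing the former over u <= x telescopes to the latter.
    The m + 1 pairings v = 0, ..., m suffice because GL is transitive on pairs with a given
    intersection dimension, so an invariant kernel has at most m + 1 values. The condition m <= n -
    m enters twice: it keeps the denominators in B nonzero, and it gives u + v <= n for u, v <= m,
    so that every intersection dimension from 0 to min(u, v) occurs in the Burnside count. *)

Section GaussBinomial.

(** * Gaussian binomials and the q-binomial theorem *)

Variable q : algC.

(* Unlike [qbinom], whose subtraction is truncated, this vanishes for [e > N]. *)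
Definition gbinom (N e : nat) : algC :=
  \prod_(i < e) ((q ^+ N - q ^+ i) / (q ^+ e - q ^+ i)).

Hypothesis q_gt1 : 1 < q.

Let q_gt0 : 0 < q. Proof. exact: lt_trans ltr01 q_gt1. Qed.
Let q_neq0 : q != 0. Proof. exact: lt0r_neq0. Qed.

Lemma expr_neq0 (r : nat) : q ^+ r != 0.
Proof. by rewrite expf_neq0. Qed.

Lemma exprBn_neq0 (i j : nat) : (i < j)%N -> q ^+ j - q ^+ i != 0.
Proof. by move=> ij; rewrite subr_eq0 gt_eqF // ltr_eXn2l. Qed.

Lemma exprB1_neq0 (r : nat) : q ^+ r.+1 - 1 != 0.
Proof. by have := @exprBn_neq0 0 r.+1; rewrite expr0; apply. Qed.

Lemma gbinom_frac N e :
  gbinom N e = (\prod_(i < e) (q ^+ N - q ^+ i)) / \prod_(i < e) (q ^+ e - q ^+ i).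
Proof. by rewrite /gbinom big_split prodfV. Qed.

Lemma gbinom0 N : gbinom N 0 = 1.
Proof. by rewrite /gbinom big_ord0. Qed.

Lemma gbinom_small N e : (N < e)%N -> gbinom N e = 0.
Proof. by move=> Ne; rewrite /gbinom (bigD1 (Ordinal Ne)) //= subrr !mul0r. Qed.

Lemma gbinom_neq0 N e : (e <= N)%N -> gbinom N e != 0.
Proof.
move=> eN; apply/prodf_neq0 => i _; rewrite mulf_neq0 ?invr_eq0 ?exprBn_neq0 //.
exact: leq_trans (ltn_ord i) eN.
Qed.

Lemma prod_expB_neq0 e : \prod_(i < e) (q ^+ e - q ^+ i) != 0.
Proof. by apply/prodf_neq0 => i _; apply: exprBn_neq0. Qed.

Let prodSS N e : \prod_(i < e.+1) (q ^+ N.+1 - q ^+ i) =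
  (q ^+ N.+1 - 1) * (q ^+ e * \prod_(i < e) (q ^+ N - q ^+ i)).
Proof.
rewrite big_ord_recl expr0 /=; congr (_ * _).
rewrite -[in q ^+ e](card_ord e) -prodr_const -big_split; apply: eq_bigr => i _ /=.
by rewrite /bump /= !exprS -mulrBr.
Qed.

Lemma gbinomSS N e : gbinom N.+1 e.+1 = (q ^+ N.+1 - 1) / (q ^+ e.+1 - 1) * gbinom N e.
Proof.
rewrite !gbinom_frac !prodSS; field.
by rewrite prod_expB_neq0 expr_neq0 exprB1_neq0.
Qed.

Lemma gbinomS N e :
  gbinom N e.+1 = (q ^+ N - q ^+ e) / (q ^+ e * (q ^+ e.+1 - 1)) * gbinom N e.
Proof.
rewrite !gbinom_frac prodSS big_ord_recr /=; field.
by rewrite prod_expB_neq0 expr_neq0 exprB1_neq0.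
Qed.

Lemma gbinom_pascal N e :
  gbinom N.+1 e.+1 = q ^+ e.+1 * gbinom N e.+1 + gbinom N e.
Proof.
rewrite gbinomSS gbinomS; have := exprB1_neq0 e; have := expr_neq0 e.
by rewrite !exprS => h1 h2; field; rewrite h1 h2.
Qed.

(** Pascal's rule writes the sum for [a.+1] at [z] as [1 - z] times the sum for [a] at [z * q]. The
    two sums that arise differ in length by one, hence the free bound [x]; terms beyond [a] are
    zero. *)
Lemma qbinomial_theorem (a x : nat) (z : algC) : (a <= x)%N ->
  \sum_(r < x.+1) (-1) ^+ r * q ^+ 'C(r, 2) * z ^+ r * gbinom a r =
  \prod_(i < a) (1 - z * q ^+ i).
Proof.
elim: a x z => [|a IH] x z ax.
  rewrite big_ord_recl big_ord0 gbinom0 !expr0 !mulr1 big1 ?addr0 // => i _.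
  by rewrite gbinom_small ?mulr0.
case: x ax => // x; rewrite ltnS => ax.
have step (i : nat) : (-1) ^+ i.+1 * q ^+ 'C(i.+1, 2) * z ^+ i.+1 * gbinom a.+1 i.+1 =
    (-1) ^+ i.+1 * q ^+ 'C(i.+1, 2) * (z * q) ^+ i.+1 * gbinom a i.+1
    - z * ((-1) ^+ i * q ^+ 'C(i, 2) * (z * q) ^+ i * gbinom a i).
  rewrite gbinom_pascal binS bin1 exprD !exprMn !exprS; ring.
rewrite [LHS]big_ord_recl; under eq_bigr => i _ do rewrite lift0 step.
rewrite sumrB -mulr_sumr.
rewrite (IH x (z * q)) //.
have := IH x.+1 (z * q) (leqW ax); rewrite [X in X = _]big_ord_recl => IHx.
have -> : (-1) ^+ (@ord0 x.+1) * q ^+ 'C(@ord0 x.+1, 2) * z ^+ (@ord0 x.+1)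
      * gbinom a.+1 (@ord0 x.+1) =
    (-1) ^+ (@ord0 x.+1) * q ^+ 'C(@ord0 x.+1, 2) * (z * q) ^+ (@ord0 x.+1) * gbinom a (@ord0 x.+1).
  by rewrite /= !gbinom0.
rewrite addrA.
under eq_bigr => i _ do rewrite -lift0.
rewrite IHx -[X in X - _]mul1r -mulrBl big_ord_recl expr0 mulr1; congr (_ * _).
by apply: eq_bigr => i _; rewrite /bump /= exprS mulrA.
Qed.

(** At [z = q / q ^+ a] the factor of index [a - 1] of the product is zero as soon as [a > 0]. This
    is the identity behind B A = 1. *)
Lemma gbinom_alternating_sum (a x : nat) : (a <= x)%N ->
  \sum_(r < x.+1) (-1) ^+ r * q ^+ 'C(r, 2) * (q / q ^+ a) ^+ r * gbinom a r = (a == 0)%N%:R.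
Proof.
move=> ax; rewrite qbinomial_theorem //; case: a ax => [|a] _; first by rewrite big_ord0.
rewrite (bigD1 ord_max) //= exprS invfM mulrA mulfV // mul1r mulVf ?expr_neq0 //.
by rewrite subrr mul0r.
Qed.

(** Each factor [q ^+ N - q ^+ i] is [- q ^+ i * (1 - q ^+ (N - i))]. This is the passage from the
    products met in counting to Pochhammer symbols. *)
Lemma qpoch_shift (N e : nat) : (e <= N)%N ->
  \prod_(i < e) (q ^+ N - q ^+ i) * qpoch q q (N - e) =
  (-1) ^+ e * q ^+ 'C(e, 2) * qpoch q q N.
Proof.
elim: e => [|e IH] eN; first by rewrite big_ord0 subn0 bin0n !mul1r.
rewrite big_ord_recr /= binS bin1 exprD exprS.
transitivity (- q ^+ e * ((\prod_(i < e) (q ^+ N - q ^+ i)) * qpoch q q (N - e))).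
  have -> : (N - e = (N - e.+1).+1)%N by lia.
  rewrite /qpoch big_ord_recr /=; set P := \prod_(i < e) _; set Y := \prod_(i < _) _.
  have -> : q ^+ N = q ^+ e * (q * q ^+ (N - e.+1)) by rewrite -exprS -exprD; congr (_ ^+ _); lia.
  ring.
by rewrite IH ?(ltnW eN) //; ring.
Qed.

Lemma qpochqq_neq0 (r : nat) : qpoch q q r != 0.
Proof.
by apply/prodf_neq0 => i _; rewrite -exprS subr_eq0 eq_sym -subr_eq0 exprB1_neq0.
Qed.

Lemma gbinom_qbinom (N e : nat) : (e <= N)%N -> gbinom N e = qbinom q N e.
Proof.
move=> eN; rewrite gbinom_frac /qbinom.
have hN := qpoch_shift eN; have he := qpoch_shift (leqnn e).
rewrite subnn [qpoch _ _ 0]big_ord0 mulr1 in he.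
have : \prod_(i < e) (q ^+ N - q ^+ i) =
   (-1) ^+ e * q ^+ 'C(e, 2) * qpoch q q N / qpoch q q (N - e).
  by rewrite -hN mulfK ?qpochqq_neq0.
move=> ->; rewrite he; field.
by rewrite !qpochqq_neq0 expr_neq0 signr_eq0.
Qed.

End GaussBinomial.

(** * Counting subspaces above, below and disjoint from given ones *)

Section Subspaces.
Variables (F : finFieldType) (n : nat).
Implicit Types (A B U R Z : 'M[F]_n) (W : {set 'rV[F]_n}).
Local Notation Gr := (subspaces F n).

Lemma subspacesP d W :
  reflect (exists2 A : 'M[F]_n, \rank A = d & W = rowg A) (W \in Gr d).
Proof.
rewrite inE; apply: (iffP existsP) => [[A /andP[/eqP rA /eqP ->]]|[A rA ->]].
  exists (<<A>>%MS); first by rewrite mxrank_gen.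
  by apply/setP=> v; rewrite !inE genmxE.
move: (row_base A) (eq_row_base A); rewrite rA => B eqB.
exists B; rewrite eqB rA eqxx /=; apply/eqP/setP=> v.
by rewrite !inE eqB.
Qed.

Lemma rowg_subspaces d A : (rowg A \in Gr d) = (\rank A == d).
Proof.
apply/subspacesP/eqP => [[B <- eqAB]|rA]; last by exists A.
by apply: eqmx_rank; rewrite -!rowgS eqAB subxx.
Qed.

Lemma card_subspace d W : W \in Gr d -> #|W| = (#|F| ^ d)%N.
Proof. by case/subspacesP=> A <- ->; rewrite card_rowg. Qed.

Lemma rowg_triv A B : (rowg A :&: rowg B == [set 0]) = (\rank (A :&: B)%MS == 0)%N.
Proof. by rewrite -rowgI (trivg_rowg (A :&: B)%MS) mxrank_eq0. Qed.

Lemma mxrank_adds_row A (v : 'rV[F]_n) :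
  ~~ (v <= A)%MS -> \rank (A + v)%MS = (\rank A).+1.
Proof.
move=> vA; have v0 : v != 0 by apply: contraNneq vA => ->; rewrite sub0mx.
have cap0 : (A :&: v)%MS = 0.
  apply/eqP; rewrite -mxrank_eq0; apply: contraNT vA => rc.
  have: (v <= A :&: v)%MS.
    have /leqifP := mxrank_leqif_sup (capmxSr A v).
    by case: ifP => // _; rewrite rank_rV v0 ltnS leqn0 (negbTE rc).
  by rewrite sub_capmx => /andP[].
by rewrite mxrank_disjoint_sum // rank_rV v0 addn1.
Qed.

(** One family covers all later counts: [R = 0] gives intervals of the subspace lattice, [U = 0]
    gives subspaces avoiding [R]. *)
Definition between d U R Z : {set {set 'rV[F]_n}} :=
  [set W in Gr d | [&& rowg U \subset W, W \subset rowg Z & W :&: rowg R == [set 0]]].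

Lemma between_rowg d U R Z A :
  (rowg A \in between d U R Z) =
  [&& \rank A == d, (U <= A)%MS, (A <= Z)%MS & \rank (A :&: R)%MS == 0%N].
Proof. by rewrite inE rowg_subspaces !rowgS rowg_triv. Qed.

(** A vector of [W] lying in [U + R] has its [R]-component in [W :&: R = 0], hence lies in [U]. So
    pairs [(W, v)] can be counted by choosing [v] first and then [W] above [U + v]. *)
Lemma between_flag d U R Z v W : (R <= Z)%MS ->
  (W \in between d U R Z) && (v \in W :\: rowg U) =
  (v \in rowg Z :\: rowg (U + R)%MS) && (W \in between d (U + v)%MS R Z).
Proof.
move=> RZ; apply/andP/andP => -[].
  move=> WB; have := WB; rewrite inE => /andP[/subspacesP[A _ eW] _].
  move: WB; rewrite {}eW between_rowg => /and4P[rA UA AZ AR].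
  rewrite !in_setD !mem_rowg between_rowg => /andP[vU vA].
  rewrite rA (submx_trans vA AZ) addsmx_sub UA vA AZ AR /=; split=> //.
  rewrite andbT; apply: contra vU => /sub_addsmxP[[a b] /= ev].
  have bR : (b *m R <= A :&: R)%MS.
    rewrite sub_capmx submxMl andbT -(addrK (a *m U) (b *m R)) addrC.
    rewrite addrC [b *m R + _]addrC -ev addmx_sub //.
    by rewrite eqmx_opp (submx_trans (submxMl _ _)).
  move: AR; rewrite mxrank_eq0 => /eqP AR.
  by move: bR; rewrite AR submx0 ev => /eqP ->; rewrite addr0 submxMl.
case/setDP; rewrite mem_rowg [v \in _]mem_rowg => vZ vUR WB.
have := WB; rewrite inE => /andP[/subspacesP[A _ eW] _].
move: WB; rewrite {}eW !between_rowg => /and4P[-> + AZ ->]; rewrite addsmx_sub AZ => /andP[-> vA].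
split=> //; rewrite in_setD !mem_rowg vA andbT.
by apply: contra vUR => vU; apply: submx_trans vU (addsmxSl _ _).
Qed.

(** Induction on the codimension [e] of [U] in [W], by double counting the pairs of [between_flag].
    The form without division holds for every [e]: when no such [W] exists, the right-hand product
    has a zero factor. *)
Lemma card_between_nat e U R Z : (U <= Z)%MS -> (R <= Z)%MS -> (\rank (U :&: R) = 0)%N ->
  (#|between (\rank U + e) U R Z| * \prod_(i < e) (#|F| ^ (\rank U + e) - #|F| ^ (\rank U + i))
   = \prod_(i < e) (#|F| ^ \rank Z - #|F| ^ (\rank U + \rank R + i)))%N.
Proof.
elim: e U => [|e IH] U UZ RZ UR.
  rewrite !big_ord0 addn0 muln1; apply/eqP/cards1P; exists (rowg U).
  apply/setP=> W; rewrite [RHS]inE; apply/idP/eqP => [WB|->]; last first.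
    by rewrite between_rowg UR UZ submx_refl !eqxx.
  have := WB; rewrite inE => /andP[/subspacesP[A _ eW] _].
  move: WB; rewrite {}eW between_rowg => /and4P[/eqP rA UA _ _].
  apply: eq_rowg; apply/eqmxP; rewrite UA andbT.
  by have := mxrank_leqif_sup UA; rewrite rA => /leqifP; case: ifP => //; rewrite ltnn.
rewrite !big_ord_recl /= !addn0 mulnA.
set d := (\rank U + e.+1)%N.
have -> : (#|between d U R Z| * (#|F| ^ d - #|F| ^ \rank U) =
           \sum_(v in rowg Z :\: rowg (U + R)%MS) #|between d (U + v)%MS R Z|)%N.
  transitivity (\sum_(W in between d U R Z) \sum_(v in W :\: rowg U) 1)%N.
    rewrite -sum_nat_const; apply: eq_bigr => W; rewrite inE => /and4P[Wd UW _ _].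
    by rewrite sum1_card cardsD (setIidPr UW) card_rowg (card_subspace Wd).
  rewrite (exchange_big_dep (fun v => v \in rowg Z :\: rowg (U + R)%MS)) /=.
    apply: eq_bigr => v vZ; rewrite sum1dep_card; apply: eq_card => W.
    by rewrite inE between_flag // vZ.
  move=> W v WB vW.
  have /andP[] // : (v \in rowg Z :\: rowg (U + R)%MS) && (W \in between d (U + v)%MS R Z).
  by rewrite -between_flag // WB.
rewrite big_distrl /=.
have rUR : \rank (U + R)%MS = (\rank U + \rank R)%N by rewrite -mxrank_sum_cap UR addn0.
rewrite (eq_bigr (fun=> \prod_(i < e) (#|F| ^ \rank Z - #|F| ^ (\rank U + \rank R + bump 0 i)))%N).
  rewrite sum_nat_const cardsD (setIidPr _) ?rowgS ?addsmx_sub ?UZ // !card_rowg.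
  by rewrite rUR.
move=> v; rewrite in_setD !mem_rowg => /andP[vUR vZ].
have vU : ~~ (v <= U)%MS by apply: contra vUR => vU; apply: submx_trans vU (addsmxSl _ _).
have rUv := mxrank_adds_row vU.
have Uv0 : \rank ((U + v)%MS :&: R)%MS = 0%N.
  apply/eqP; rewrite -(eqn_add2l (\rank ((U + v)%MS + R)%MS)) mxrank_sum_cap rUv addn0.
  have -> : \rank ((U + v) + R)%MS = \rank ((U + R) + v)%MS.
    by rewrite -!addsmxA (addsmxC v).
  by rewrite mxrank_adds_row // rUR.
have := IH (U + v)%MS; rewrite rUv addSnnS addsmx_sub UZ vZ => /(_ isT RZ Uv0) IHv.
transitivity (\prod_(i < e) (#|F| ^ \rank Z - #|F| ^ ((\rank U).+1 + \rank R + i)))%N.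
  by rewrite -IHv; congr (_ * _)%N; apply: eq_bigr => i _; rewrite addSnnS.
by apply: eq_bigr => i _; rewrite /bump /= !addSn addnS.
Qed.

End Subspaces.

(** * The matrix B, the kernel E_x, and B A = 1 *)

Section Kernels.
Variables (F : finFieldType) (n : nat).
Implicit Types (A B U R Z : 'M[F]_n) (W : {set 'rV[F]_n}).
Local Notation Gr := (subspaces F n).
Local Notation q := (#|F|%:R : algC).
Local Notation gb := (gbinom q).

Lemma cardF_gt1 : 1 < q.
Proof. by rewrite ltr1n card_finNzRing_gt1. Qed.
Hint Resolve cardF_gt1 : core.

Lemma card_between d U R Z : (\rank U <= d)%N -> (U <= Z)%MS -> (R <= Z)%MS ->
  (\rank (U :&: R) = 0)%N ->
  #|between d U R Z|%:R =
  q ^+ (\rank R * (d - \rank U)) * gb (\rank Z - \rank U - \rank R) (d - \rank U).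
Proof.
move=> Ud UZ RZ UR; have eq_d : d = (\rank U + (d - \rank U))%N by rewrite subnKC.
have := card_between_nat (d - \rank U) UZ RZ UR; rewrite -eq_d.
move: (d - \rank U)%N eq_d => e eq_d /(congr1 (fun k : nat => k%:R : algC)).
have URZ : (\rank U + \rank R <= \rank Z)%N.
  by rewrite -mxrank_sum_cap UR addn0 mxrankS // addsmx_sub UZ.
have cF : (0 < #|F|)%N by rewrite (leq_trans _ (card_finNzRing_gt1 F)).
rewrite natrM !natr_prod => card_eq.
have den : \prod_(i < e) ((#|F| ^ d - #|F| ^ (\rank U + i))%N%:R : algC) =
    q ^+ (\rank U * e) * \prod_(i < e) (q ^+ e - q ^+ i).
  rewrite exprM -[in X in _ ^+ X](card_ord e) -prodr_const -big_split.
  apply: eq_bigr => i _ /=; rewrite natrB; last by rewrite leq_pexp2l // eq_d leq_add2l ltnW.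
  by rewrite !natrX eq_d !exprD -mulrBr.
have num : \prod_(i < e) ((#|F| ^ \rank Z - #|F| ^ (\rank U + \rank R + i))%N%:R : algC) =
    q ^+ ((\rank U + \rank R) * e) *
    \prod_(i < e) (q ^+ (\rank Z - \rank U - \rank R) - q ^+ i).
  (* Truncated subtraction agrees factor by factor with that of [algC] only for small [e]; beyond
     that both products contain a zero factor. *)
  rewrite -subnDA; have [eZ|Ze] := leqP e (\rank Z - (\rank U + \rank R)).
    rewrite exprM -[in X in _ ^+ X](card_ord e) -prodr_const -big_split.
    apply: eq_bigr => i _ /=; rewrite natrB; last first.
      by rewrite leq_pexp2l // -leq_subRL // (leq_trans _ eZ) // ltnW.
    by rewrite !natrX -[in LHS](subnKC URZ) !exprD -mulrBr.
  rewrite [LHS](bigD1 (Ordinal Ze)) //= [X in _ = _ * X](bigD1 (Ordinal Ze)) //=.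
  by rewrite subnKC // subnn subrr !(mul0r, mulr0).
have den0 : q ^+ (\rank U * e) != 0 by rewrite expr_neq0.
move: card_eq; rewrite den num gbinom_frac => card_eq.
apply: (mulIf (mulf_neq0 den0 (prod_expB_neq0 cardF_gt1 e))).
rewrite card_eq mulnDl exprD; field.
exact: prod_expB_neq0.
Qed.

Definition avoid (r : nat) W W' : {set {set 'rV[F]_n}} :=
  [set R in Gr r | (R \subset W) && (R :&: W' == [set 0])].

Definition subsp_interval (d : nat) W W' : {set {set 'rV[F]_n}} :=
  [set U in Gr d | (W \subset U) && (U \subset W')].

Lemma cap0set W : (0 : 'rV[F]_n) \in W -> W :&: [set 0] = [set 0].
Proof. by move=> W0; apply/setIidPr; rewrite sub1set. Qed.

Lemma rowg_eq0 : rowg (0 : 'M[F]_n) = [set 0].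
Proof. exact: rowg0. Qed.

Lemma subspace0 d W : W \in Gr d -> 0 \in W.
Proof. by case/subspacesP => A _ ->; rewrite mem_rowg sub0mx. Qed.

(** Inside [A], avoiding [B] is avoiding [A :&: B]; the latter lies in [A], as [card_between]
    requires. *)
Lemma avoid_between r A B : avoid r (rowg A) (rowg B) = between r 0 (A :&: B)%MS A.
Proof.
apply/setP => W; rewrite [LHS]in_set [RHS]in_set.
case Wd: (W \in subspaces _ _ _) => //=; rewrite rowg_eq0 sub1set (subspace0 Wd) /=.
case WA: (W \subset rowg A) => //=; congr (_ == _).
by rewrite rowgI setIA (setIidPl WA).
Qed.

Lemma interval_between d A B : subsp_interval d (rowg A) (rowg B) = between d A 0 B.
Proof.
apply/setP => W; rewrite [LHS]in_set [RHS]in_set.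
case Wd: (W \in subspaces _ _ _) => //=; rewrite rowg_eq0 cap0set ?(subspace0 Wd) //.
by rewrite eqxx andbT.
Qed.

Lemma card_avoid r A B :
  #|avoid r (rowg A) (rowg B)|%:R =
  q ^+ (\rank (A :&: B)%MS * r) * gb (\rank A - \rank (A :&: B)%MS) r.
Proof.
rewrite avoid_between card_between ?sub0mx ?capmxSl ?mxrank0 ?subn0 //.
by rewrite cap0mx mxrank0.
Qed.

Lemma card_interval d A B : (\rank A <= d)%N -> (A <= B)%MS ->
  #|subsp_interval d (rowg A) (rowg B)|%:R = gb (\rank B - \rank A) (d - \rank A).
Proof.
move=> Ad AB; rewrite interval_between card_between ?sub0mx //.
  by rewrite mxrank0 mul0n expr0 mul1r subn0.
by rewrite capmx0 mxrank0.
Qed.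

(** The sign and [q ^+ 'C(r, 2)] are those of the q-binomial theorem. The denominator is, up to a
    power of q, the number of m-spaces above an x-space that avoid an r-space; [(q / q ^+ m) ^+ r]
    is what the powers of q from the two counts in B A turn into [(q / q ^+ a) ^+ r]. *)
Definition beta (x m r : nat) : algC :=
  (-1) ^+ r * q ^+ 'C(r, 2) * (q / q ^+ m) ^+ r / gb (n - x - r) (m - x).

(* [bker] is a left inverse of the inclusion matrix between [Gr x] and [Gr m],
   so that [Eker] is the idempotent of rank [#|Gr x|] commuting with GL_n. *)
Definition bker (x m : nat) W W' : algC := \sum_(r < x.+1) beta x m r * #|avoid r W W'|%:R.

Definition Eker (x m : nat) W W' : algC :=
  \sum_(r < x.+1) beta x m r * gb (m - r) (x - r) * #|avoid r W W'|%:R.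

(** Flags [R] in [U] in [W] are counted from either end; the condition on [R :&: W'] does not
    involve [U]. *)
Lemma sum_avoid_sub (x r : nat) W W' :
  (\sum_(U in Gr x | U \subset W) #|avoid r U W'|)%N =
  (\sum_(R in avoid r W W') #|subsp_interval x R W|)%N.
Proof.
under eq_bigr => U _ do rewrite -sum1_card.
rewrite (exchange_big_dep (mem (avoid r W W'))) /=; last first.
  move=> U R /andP[_ UW]; rewrite !inE => /and3P[-> RU ->].
  by rewrite (subset_trans RU UW).
apply: eq_bigr => R; rewrite inE => /and3P[Rr RW RW'].
rewrite sum1dep_card; apply: eq_card => U; rewrite !inE.
by move: Rr; rewrite inE => ->; rewrite RW' andbT /= -andbA [(R \subset U) && _]andbC.
Qed.

Lemma sum_bker_sub x m W W' : W \in Gr m ->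
  \sum_(U in Gr x | U \subset W) bker x m U W' = Eker x m W W'.
Proof.
move=> Wm; rewrite /bker exchange_big; apply: eq_bigr => r _ /=.
have rx : (r <= x)%N by rewrite -ltnS.
rewrite -mulr_sumr -natr_sum sum_avoid_sub // -mulrA; congr (_ * _).
rewrite natr_sum (eq_bigr (fun=> gb (m - r) (x - r))) ?sumr_const ?mulr_natr // => R.
rewrite inE => /andP[/subspacesP[A rA ->] /andP[+ _]].
case/subspacesP: Wm => B <- ->; rewrite rowgS -rA => AB.
by rewrite card_interval // rA.
Qed.

Lemma bker_inverse x m (U U' : {set 'rV[F]_n}) :
  U \in Gr x -> U' \in Gr x -> (x <= m)%N -> (m <= n - m)%N ->
  \sum_(W in Gr m | U' \subset W) bker x m U W = (U == U')%:R.
Proof.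
case/subspacesP=> A rA ->; case/subspacesP=> B rB -> xm mn.
rewrite /bker exchange_big /=.
(* The codimension of the intersection in either space: it is zero exactly when the two x-spaces
   coincide, which is the right-hand side of [gbinom_alternating_sum]. *)
set a := (x - \rank (A :&: B)%MS)%N.
have ax : (a <= x)%N by rewrite leq_subr.
transitivity (\sum_(r < x.+1) (-1) ^+ r * q ^+ 'C(r, 2) * (q / q ^+ a) ^+ r * gb a r).
  apply: eq_bigr => r _; have rx : (r <= x)%N by rewrite -ltnS.
  rewrite -mulr_sumr -natr_sum.
  (* If [R] avoids some [W] above [U'], it avoids [U']; so [R] can be chosen first, and the number
     of suitable [W] is then independent of [R]. *)
  have -> : (\sum_(W in Gr m | rowg B \subset W) #|avoid r (rowg A) W| =
             \sum_(R in avoid r (rowg A) (rowg B))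
                #|[set W in Gr m | (rowg B \subset W) && (R :&: W == [set 0%R])]|)%N.
    under eq_bigr => W _ do rewrite -sum1_card.
    rewrite (exchange_big_dep (mem (avoid r (rowg A) (rowg B)))) /=; last first.
      move=> W R /andP[Wm BW]; rewrite !inE => /and3P[-> -> /eqP RW] /=.
      rewrite eqEsubset -{1}RW setIS //= sub1set inE.
      have : 0 \in R :&: W by rewrite RW set11.
      by rewrite inE => /andP[-> _]; rewrite mem_rowg sub0mx.
    apply: eq_bigr => R; rewrite inE => /and3P[Rr RA RB].
    rewrite sum1dep_card; apply: eq_card => W; rewrite !inE; move: Rr; rewrite inE => ->.
    by rewrite RA /= -andbA.
  rewrite natr_sum (eq_bigr (fun=> q ^+ (r * (m - x)) * gb (n - x - r) (m - x))); last first.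
    move=> R; rewrite inE => /and3P[/subspacesP[C rC ->] _].
    rewrite rowg_triv => /eqP CB.
    have -> : [set W in Gr m | (rowg B \subset W) && (rowg C :&: W == [set 0])] =
        between m B C 1%:M.
      by apply/setP => W; rewrite !inE rowg1 subsetT setIC.
    by rewrite card_between ?submx1 ?rB ?rC ?mxrank1 // capmxC.
  rewrite sumr_const -[_ *+ _]mulr_natr card_avoid rA -/a /beta.
  have g0 : gb (n - x - r) (m - x) != 0 by rewrite gbinom_neq0 //; lia.
  have -> : q ^+ (\rank (A :&: B)%MS * r) = q ^+ (x * r) / q ^+ (a * r).
    have rAB : (\rank (A :&: B)%MS <= x)%N by rewrite -rA mxrankS // capmxSl.
    have -> : (x * r = \rank (A :&: B)%MS * r + a * r)%N.
      by rewrite /a mulnBl subnKC // leq_mul2r rAB orbT.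
    by rewrite exprD mulfK ?expr_neq0.
  have -> : q ^+ (r * (m - x)) = q ^+ (m * r) / q ^+ (x * r).
    have -> : (m * r = r * (m - x) + x * r)%N by nia.
    by rewrite exprD mulfK ?expr_neq0.
  rewrite !expr_div_n -!exprM; field.
  by rewrite g0 !expr_neq0.
rewrite gbinom_alternating_sum //; congr (_%:R).
rewrite subn_eq0.
have := mxrank_leqif_sup (capmxSl A B); rewrite rA => /leqifP.
have := mxrank_leqif_sup (capmxSr A B); rewrite rB => /leqifP.
rewrite !sub_capmx !submx_refl andbT /=.
rewrite eqEsubset !rowgS.
by case: (A <= B)%MS; case: (B <= A)%MS; rewrite /= => h1 h2; lia.
Qed.

End Kernels.

(** * The action of GL on subspaces and on pairs of subspaces *)

Section Action.
Variables (F : finFieldType) (n : nat).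
Implicit Types (A B : 'M[F]_n) (W : {set 'rV[F]_n}) (g h : 'M[F]_n).
Local Notation Gr := (subspaces F n).
Local Notation GL := (GLset F n).

Lemma actS_rowg g A : actS g (rowg A) = rowg (A *m g).
Proof.
apply/setP => v; apply/imsetP/idP => [[u + ->]|].
  by rewrite !mem_rowg; apply: submxMr.
rewrite mem_rowg => /submxP[D ->]; exists (D *m A); last by rewrite mulmxA.
by rewrite mem_rowg submxMl.
Qed.

Lemma actSM g h W : actS h (actS g W) = actS (g *m h) W.
Proof. by rewrite /actS -imset_comp; apply: eq_imset => v /=; rewrite mulmxA. Qed.

Lemma actS1 W : actS 1%:M W = W.
Proof. by rewrite /actS (eq_imset (g := id)) ?imset_id // => v; rewrite mulmx1. Qed.

Lemma actSK g : g \in unitmx -> cancel (@actS F n g) (actS (invmx g)).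
Proof. by move=> gU W; rewrite actSM mulmxV // actS1. Qed.

Lemma actSKV g : g \in unitmx -> cancel (actS (invmx g)) (@actS F n g).
Proof. by move=> gU W; rewrite actSM mulVmx // actS1. Qed.

Lemma actS_subset g W W' : g \in unitmx -> (actS g W \subset actS g W') = (W \subset W').
Proof.
move=> gU; apply/idP/idP; last exact: imsetS.
by move/(imsetS (mulmxr (invmx g))); rewrite -![[set _ | _ in _]]/(actS _ _) !actSK.
Qed.

Lemma actS_subspaces d g W : g \in unitmx -> (actS g W \in Gr d) = (W \in Gr d).
Proof.
have sub h V : h \in unitmx -> V \in Gr d -> actS h V \in Gr d.
  move=> hU /subspacesP[A rA ->]; rewrite actS_rowg rowg_subspaces.
  by rewrite mxrankMfree ?rA // row_free_unit.
move=> gU; apply/idP/idP; last exact: sub.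
by move/(sub (invmx g)); rewrite unitmx_inv actSK //; apply.
Qed.

Lemma sum_GL_mull (T : nmodType) (f : 'M[F]_n -> T) h : h \in unitmx ->
  \sum_(g in GL) f g = \sum_(g in GL) f (h *m g).
Proof.
move=> hU; rewrite (reindex_onto (fun g => h *m g) (fun g => invmx h *m g)) => [|g _].
  by apply: eq_bigl => g; rewrite !inE unitmx_mul hU mulmxA mulVmx // mul1mx eqxx andbT.
by rewrite mulmxA mulmxV // mul1mx.
Qed.

Lemma sum_GL_mulr (T : nmodType) (f : 'M[F]_n -> T) h : h \in unitmx ->
  \sum_(g in GL) f g = \sum_(g in GL) f (g *m h).
Proof.
move=> hU; rewrite (reindex_onto (fun g => g *m h) (fun g => g *m invmx h)) => [|g _].
  by apply: eq_bigl => g; rewrite !inE unitmx_mul hU andbT -mulmxA mulmxV // mulmx1 eqxx andbT.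
by rewrite -mulmxA mulVmx // mulmx1.
Qed.

Lemma sum_Gr_act (T : nmodType) d (f : {set 'rV[F]_n} -> T) g : g \in unitmx ->
  \sum_(W in Gr d) f W = \sum_(W in Gr d) f (actS g W).
Proof.
move=> gU; rewrite (reindex_onto (actS g) (actS (invmx g))) => [|W _].
  by apply: eq_bigl => W; rewrite actS_subspaces // actSK // eqxx andbT.
by rewrite actSKV.
Qed.

Lemma permchar_conj d g h : h \in unitmx ->
  permchar d (h *m g *m invmx h) = permchar d g.
Proof.
move=> hU; rewrite /permchar; congr (_%:R).
rewrite -(card_imset _ (can_inj (actSK hU))); apply: eq_card => W.
apply/imsetP/idP => [[V + ->]|].
  rewrite !inE => /andP[Vd /eqP eV].
  have := actS_subspaces d V hU; rewrite !inE => ->; rewrite Vd /=.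
  by rewrite actSM -{2}eV !actSM -[in X in _ == X]mulmxA mulVmx // mulmx1.
rewrite inE => /andP[Wd /eqP eW]; exists (actS (invmx h) W); last by rewrite actSKV.
rewrite inE actS_subspaces ?unitmx_inv // Wd actSM /= !mulmxA mulVmx // mul1mx.
by rewrite -actSM eW.
Qed.

Lemma mx_glue (P Q f1 f2 : 'M[F]_n) : (P :&: Q)%MS = 0 ->
  exists2 f : 'M[F]_n, P *m f = P *m f1 & Q *m f = Q *m f2.
Proof.
move=> PQ; have QP : (Q :&: P)%MS = 0 by rewrite capmxC.
exists (proj_mx P Q *m f1 + proj_mx Q P *m f2); rewrite mulmxDr
  [X in X + _ = _]mulmxA [X in _ + X = _]mulmxA.
  by rewrite proj_mx_id // proj_mx_0 // mul0mx addr0.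
by rewrite proj_mx_0 // proj_mx_id // mul0mx add0r.
Qed.

Lemma mxrank_diff A B : \rank (A :\: B)%MS = (\rank A - \rank (A :&: B)%MS)%N.
Proof. by rewrite -(mxrank_cap_compl A B) addKn. Qed.

(** [A + B] is the direct sum of [A :&: B] and of complements of it in [A] and in [B]. Isomorphisms
    of the three pieces are glued by projections, and the result, injective on [A + B], extends to
    an invertible matrix. *)
Lemma unitmx_pair_trans A B A' B' : \rank A = \rank A' -> \rank B = \rank B' ->
  \rank (A :&: B)%MS = \rank (A' :&: B')%MS ->
  exists2 g : 'M[F]_n, g \in unitmx & (A *m g :=: A')%MS /\ (B *m g :=: B')%MS.
Proof.
move=> rA rB rC.
have [fC _ eC] := eq_rank_unitmx rC.
have [|fX _ eX] := @eq_rank_unitmx _ _ _ _ (A :\: B)%MS (A' :\: B')%MS.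
  by rewrite !mxrank_diff rA rC.
have [|fY _ eY] := @eq_rank_unitmx _ _ _ _ (B :\: A)%MS (B' :\: A')%MS.
  by rewrite !mxrank_diff rB ![(B :&: A)%MS]capmxC ![(B' :&: A')%MS]capmxC rC.
have XY : ((A :\: B) :&: (B :\: A))%MS = 0.
  apply/eqP; rewrite -submx0 -(capmx_diff A B) sub_capmx capmxSl /=.
  exact: submx_trans (capmxSr _ _) (diffmxSl _ _).
have eA : ((A :&: B) + (A :\: B) :=: A)%MS.
  by rewrite addsmxC; apply: addsmx_diff_cap_eq.
have eB : ((A :&: B) + (B :\: A) :=: B)%MS.
  by rewrite addsmxC capmxC; apply: addsmx_diff_cap_eq.
have eAB : (A :&: B + ((A :\: B) + (B :\: A)) :=: A + B)%MS.
  have h1 : (A :&: B <= A + B)%MS := submx_trans (capmxSl A B) (addsmxSl A B).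
  have h2 : (A :\: B <= A + B)%MS := submx_trans (diffmxSl A B) (addsmxSl A B).
  have h3 : (B :\: A <= A + B)%MS := submx_trans (diffmxSl B A) (addsmxSr A B).
  apply/eqmxP/andP; split; first by rewrite !addsmx_sub h1 h2 h3.
  rewrite addsmx_sub; apply/andP; split.
    by apply: (@submx_trans _ _ _ _ _ _ ((A :&: B) + (A :\: B))%MS);
      [rewrite eA | rewrite addsmxS ?addsmxSl].
  by apply: (@submx_trans _ _ _ _ _ _ ((A :&: B) + (B :\: A))%MS);
    [rewrite eB | rewrite addsmxS ?addsmxSr].
have CXY : ((A :&: B) :&: ((A :\: B) + (B :\: A)))%MS = 0.
  apply/eqP; rewrite -mxrank_eq0; have := mxrank_sum_cap (A :&: B)%MS ((A :\: B) + (B :\: A))%MS.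
  rewrite eAB (mxrank_disjoint_sum XY) !mxrank_diff [(B :&: A)%MS]capmxC.
  have := mxrank_sum_cap A B; have := mxrankS (capmxSl A B); have := mxrankS (capmxSr A B).
  by lia.
have [f1 fX1 fY1] := mx_glue fX fY XY.
have [f fC2 fXY2] := mx_glue fC f1 CXY.
have sub_eq (m1 : nat) (P : 'M[F]_(m1, n)) (Q h1 h2 : 'M[F]_n) :
    (P <= Q)%MS -> Q *m h1 = Q *m h2 -> P *m h1 = P *m h2.
  by move=> /submxP[D ->]; rewrite -!mulmxA => ->.
have {fX1}fX2 : (A :\: B)%MS *m f = (A :\: B)%MS *m fX.
  by rewrite -fX1; apply: sub_eq fXY2; apply: addsmxSl.
have {fY1 fXY2}fY2 : (B :\: A)%MS *m f = (B :\: A)%MS *m fY.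
  by rewrite -fY1; apply: sub_eq fXY2; apply: addsmxSr.
have Af : (A *m f :=: A')%MS.
  apply: eqmx_trans (eqmx_sym (eqmxMr f eA)) _.
  apply: eqmx_trans (addsmxMr _ _ _) _; rewrite fC2 fX2.
  apply: eqmx_trans (adds_eqmx (eqmx_sym eC) (eqmx_sym eX)) _.
  by rewrite addsmxC; apply: addsmx_diff_cap_eq.
have Bf : (B *m f :=: B')%MS.
  apply: eqmx_trans (eqmx_sym (eqmxMr f eB)) _.
  apply: eqmx_trans (addsmxMr _ _ _) _; rewrite fC2 fY2.
  apply: eqmx_trans (adds_eqmx (eqmx_sym eC) (eqmx_sym eY)) _.
  by rewrite addsmxC capmxC; apply: addsmx_diff_cap_eq.
have [|g gU eg] := @complete_unitmx _ _ _ (A + B)%MS f.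
  rewrite (eqmx_rank (A := ((A + B)%MS *m f)) (B := (A' + B')%MS)); last first.
    by apply/eqmxP; apply: eqmx_trans (addsmxMr _ _ _) _; apply: adds_eqmx.
  by have := mxrank_sum_cap A B; have := mxrank_sum_cap A' B'; lia.
exists g => //; split.
  by rewrite -(sub_eq _ _ _ _ _ (addsmxSl A B) eg).
by rewrite -(sub_eq _ _ _ _ _ (addsmxSr A B) eg).
Qed.

Lemma GL_pair_trans a b W W' V V' :
  W \in Gr a -> V \in Gr a -> W' \in Gr b -> V' \in Gr b ->
  #|W :&: W'| = #|V :&: V'| ->
  exists2 g : 'M[F]_n, g \in unitmx & (actS g W = V) /\ (actS g W' = V').
Proof.
move=> /subspacesP[A rA ->] /subspacesP[A' rA' ->] /subspacesP[B rB ->] /subspacesP[B' rB' ->].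
rewrite -!rowgI !card_rowg => /eqP; rewrite eqn_exp2l ?card_finNzRing_gt1 // => /eqP rC.
have [||g gU [eA eB]] := unitmx_pair_trans _ _ rC; rewrite ?rA ?rB //.
by exists g => //; rewrite !actS_rowg (eq_rowg eA) (eq_rowg eB).
Qed.

End Action.

(** * Burnside's lemma and the traces of products of kernels *)

Section Traces.
Variables (F : finFieldType) (n : nat).
Implicit Types (A B : 'M[F]_n) (U W : {set 'rV[F]_n}) (g h : 'M[F]_n).
Local Notation Gr := (subspaces F n).
Local Notation GL := (GLset F n).
Local Notation q := (#|F|%:R : algC).
Local Notation gb := (gbinom q).
Hint Resolve cardF_gt1 : core.

Lemma set_card_neq0 (T : finType) (X : {set T}) : (#|X|%:R : algC) != 0 -> exists x, x \in X.
Proof. by rewrite pnatr_eq0 cards_eq0 => /set0Pn. Qed.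

(** Inside a u-space take an i-space [I] with a complement [R]; a v-space above [I] that avoids [R]
    meets the u-space exactly in [I]. Each choice is possible because the corresponding count is
    nonzero. *)
Lemma Gr_pair_exists u v i : (i <= u)%N -> (i <= v)%N -> (u + v - i <= n)%N ->
  exists U V, [/\ U \in Gr u, V \in Gr v & #|U :&: V| = (#|F| ^ i)%N].
Proof.
move=> iu iv uvn.
have sub (A : 'M[F]_n) (d : nat) : (d <= \rank A)%N ->
    exists2 B : 'M[F]_n, \rank B = d & (B <= A)%MS.
  move=> dA; have [|W] := @set_card_neq0 _ (subsp_interval d (rowg (0 : 'M[F]_n)) (rowg A)).
    by rewrite card_interval ?sub0mx ?mxrank0 // !subn0 gbinom_neq0.
  rewrite inE => /and3P[/subspacesP[B rB ->] _]; rewrite rowgS => BA.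
  by exists B.
have [|A rA _] := sub 1%:M u; first by rewrite mxrank1; lia.
have [|I rI IA] := sub A i; first by rewrite rA.
pose R := (A :\: I)%MS.
have rAI : \rank (A :&: I)%MS = i.
  by rewrite -[in RHS]rI; apply/eqmx_rank; rewrite capmxSr sub_capmx IA submx_refl.
have rR : \rank R = (u - i)%N by rewrite mxrank_diff rA rAI.
have IR : \rank (I :&: R)%MS = 0%N by rewrite capmxC capmx_diff mxrank0.
have [|V] := @set_card_neq0 _ (between v I R 1%:M).
  rewrite card_between ?rI ?submx1 // mulf_neq0 ?expr_neq0 ?gbinom_neq0 //.
  by rewrite rR mxrank1; lia.
rewrite inE => /andP[/subspacesP[B rB ->]]; rewrite rowgS rowg_triv.
case/and3P=> IB _ /eqP BR.
exists (rowg A), (rowg B); rewrite !rowg_subspaces rA rB !eqxx; split=> //.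
rewrite -rowgI card_rowg; congr (_ ^ _)%N; apply/eqP; rewrite eqn_leq; apply/andP; split; last first.
  by rewrite -rI mxrankS // sub_capmx IA.
have := mxrank_sum_cap (A :&: B)%MS R.
have -> : \rank ((A :&: B) :&: R)%MS = 0%N.
  by apply/eqP; rewrite -leqn0 -BR mxrankS // capmxS // capmxSr.
have : (\rank ((A :&: B) + R)%MS <= \rank A)%N.
  by rewrite mxrankS // addsmx_sub capmxSl diffmxSl.
by rewrite rA rR; lia.
Qed.

Definition stab_pair (P : {set 'rV[F]_n} * {set 'rV[F]_n}) : {set 'M[F]_n} :=
  [set g in GL | (actS g P.1 == P.1) && (actS g P.2 == P.2)].

Definition pairs_meeting (u v i : nat) : {set {set 'rV[F]_n} * {set 'rV[F]_n}} :=
  [set P in setX (Gr u) (Gr v) | #|P.1 :&: P.2| == (#|F| ^ i)%N].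

Lemma actS_cap g U W : g \in unitmx -> actS g (U :&: W) = actS g U :&: actS g W.
Proof.
move=> gU; apply: imsetI => x y _ _ /(congr1 (mulmx^~ (invmx g))).
by rewrite -!mulmxA mulmxV // !mulmx1.
Qed.

Lemma card_actS g W : g \in unitmx -> #|actS g W| = #|W|.
Proof.
move=> gU; apply: card_imset => x y /(congr1 (mulmx^~ (invmx g))).
by rewrite -!mulmxA mulmxV // !mulmx1.
Qed.

(** [pairs_meeting u v i] is a single orbit, and the elements sending [P0] to [P] form a coset of
    the stabilizer of [P]. *)
Lemma sum_stab_pair u v i P0 : P0 \in pairs_meeting u v i ->
  (\sum_(P in pairs_meeting u v i) #|stab_pair P| = #|GL|)%N.
Proof.
case: P0 => W0 V0 P0i.
have := P0i; rewrite inE in_setX => /andP[/andP[/= W0u V0v] /eqP c0].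
rewrite -sum1_card.
rewrite (partition_big (fun g => (actS g W0, actS g V0)) (mem (pairs_meeting u v i))) /=; last first.
  move=> g; rewrite !inE => gU; have := W0u; have := V0v.
  rewrite -(actS_subspaces _ W0 gU) -(actS_subspaces _ V0 gU) !inE => -> -> /=.
  by rewrite -actS_cap // card_actS // c0.
apply: eq_bigr => -[W V]; rewrite inE in_setX => /andP[/andP[/= Wu Vv] /eqP c].
have [|h hU [eW eV]] := GL_pair_trans W0u Wu V0v Vv; first by rewrite c0 c.
rewrite sum1dep_card -(@card_imset _ _ (fun g => h *m g) (mem (stab_pair (W, V)))); last first.
  by move=> x y /(congr1 (mulmx (invmx h))); rewrite !mulmxA mulVmx // !mul1mx.
apply: eq_card => g; apply/imsetP/idP => [[g0 + ->]|].
  rewrite !inE /= => /andP[g0U /andP[/eqP e1 /eqP e2]].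
  by rewrite unitmx_mul hU g0U -!actSM eW eV e1 e2 eqxx.
rewrite !inE xpair_eqE => /and3P[gU /eqP e1 /eqP e2].
exists (invmx h *m g); last by rewrite mulmxA mulmxV // mul1mx.
rewrite !inE unitmx_mul unitmx_inv hU gU /=.
by rewrite -{1}eW -{1}eV !actSM !mulmxA mulmxV // mul1mx e1 e2 !eqxx.
Qed.

Lemma permchar_prod u v g : g \in GL ->
  permchar u g * permchar v g = \sum_(P in setX (Gr u) (Gr v)) (g \in stab_pair P)%:R :> algC.
Proof.
move=> gU; rewrite /permchar -natrM -cardsX -natr_sum -big_mkcondr sum1dep_card.
congr (_%:R); apply: eq_card => -[U V]; move: gU; rewrite !inE => -> /=.
by rewrite andbACA.
Qed.

(* Burnside's lemma: the orbits on [Gr u * Gr v] are given by the dimension of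
   the intersection, which takes the values [0 .. minn u v]. *)
Lemma sum_permchar_prod u v : (u + v <= n)%N ->
  \sum_(g in GL) permchar u g * permchar v g = (#|GL| * (minn u v).+1)%:R.
Proof.
move=> uvn; rewrite (eq_bigr _ (@permchar_prod u v)) exchange_big /=.
rewrite (eq_bigr (fun P => #|stab_pair P|%:R)) => [|P _]; last first.
  rewrite -natr_sum -big_mkcondr sum1dep_card; congr (_%:R); apply: eq_card => g.
  by rewrite !inE; case: (g \in unitmx).
rewrite -natr_sum; congr (_%:R).
pose rk (P : {set 'rV[F]_n} * {set 'rV[F]_n}) : 'I_(minn u v).+1 :=
  inord (\rank (rowg_mx (P.1 :&: P.2))).
rewrite (partition_big rk predT) //= -[in RHS](card_ord (minn u v).+1) mulnC -sum_nat_const.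
apply: eq_bigr => i _.
have iuv : (i <= minn u v)%N by rewrite -ltnS.
have [||| U [V [Uu Vv c]]] := @Gr_pair_exists u v i; [lia|lia|lia|].
rewrite -(@sum_stab_pair u v i (U, V)); last by rewrite inE in_setX Uu Vv /= c.
apply: eq_bigl => -[W W']; rewrite [RHS]inE.
case WW: ((W, W') \in setX _ _) => //=.
move: WW; rewrite in_setX => /andP[/= /subspacesP[A rA ->] /subspacesP[B rB ->]].
rewrite /rk /= -!rowgI card_rowg eqn_exp2l ?card_finNzRing_gt1 // rowgK.
rewrite -val_eqE /= inordK // ltnS leq_min -{1}rA -rB.
by rewrite !mxrankS ?capmxSl ?capmxSr.
Qed.

(** Cyclicity of the trace: since [g] preserves inclusion, reindexing [W] by [g] leaves the entry of
    B A at [U] and [g U], so the trace counts the fixed [U]. *)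
Lemma sum_Eker_act x m g : g \in unitmx -> (x <= m)%N -> (m <= n - m)%N ->
  \sum_(W in Gr m) Eker x m W (actS g W) = permchar x g.
Proof.
move=> gU xm mn.
transitivity (\sum_(W in Gr m) \sum_(U in Gr x | U \subset W) bker x m U (actS g W)).
  by apply: eq_bigr => W Wm; rewrite sum_bker_sub.
rewrite (exchange_big_dep (mem (Gr x))) /=; last by move=> W U _ /andP[].
transitivity (\sum_(U in Gr x) ((U == actS g U)%:R : algC)).
  apply: eq_bigr => U Ux; rewrite -(bker_inverse Ux _ xm mn) ?actS_subspaces //.
  rewrite [RHS]big_mkcondr (sum_Gr_act _ _ gU) [LHS]big_mkcondr /=; apply: eq_bigr => W _.
  by rewrite Ux actS_subset.
rewrite -natr_sum /permchar -big_mkcondr sum1dep_card; congr (_%:R).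
by apply: eq_card => W; rewrite !inE [_ == W]eq_sym.
Qed.

Lemma card_avoid_eq (r m : nat) W W' V V' :
  W \in Gr m -> W' \in Gr m -> V \in Gr m -> V' \in Gr m ->
  #|W :&: W'| = #|V :&: V'| -> #|avoid r W W'|%:R = #|avoid r V V'|%:R :> algC.
Proof.
move=> /subspacesP[A rA ->] /subspacesP[B _ ->] /subspacesP[C rC ->] /subspacesP[D _ ->].
rewrite -!rowgI !card_rowg => /eqP; rewrite eqn_exp2l ?card_finNzRing_gt1 // => /eqP rk.
by rewrite !card_avoid rA rC rk.
Qed.

Lemma Eker_inv x m W W' V V' :
  W \in Gr m -> W' \in Gr m -> V \in Gr m -> V' \in Gr m ->
  #|W :&: W'| = #|V :&: V'| -> Eker x m W W' = Eker x m V V' :> algC.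
Proof.
by move=> Wm W'm Vm V'm c; apply: eq_bigr => r _; rewrite (card_avoid_eq r Wm W'm Vm V'm c).
Qed.

(** Not visible from [avoid], which treats its arguments differently, but between m-spaces the count
    depends only on the dimension of the intersection. *)
Lemma Eker_sym x m W W' : W \in Gr m -> W' \in Gr m -> Eker x m W W' = Eker x m W' W.
Proof. by move=> Wm W'm; apply: Eker_inv => //; rewrite setIC. Qed.

Lemma card_Gr_interval x v m Y W : Y \in Gr x -> W \in Gr m -> (x <= v)%N -> (v <= m)%N ->
  #|subsp_interval v Y W|%:R = gb (m - x) (v - x) * (Y \subset W)%:R.
Proof.
move=> /subspacesP[A rA ->] /subspacesP[B rB ->] xv vm; rewrite rowgS.
have [AB|AB] := boolP (A <= B)%MS; first by rewrite card_interval ?rA ?rB ?mulr1.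
rewrite mulr0 (_ : subsp_interval _ _ _ = set0) ?cards0 //.
apply/setP => V; rewrite in_set0 inE; apply/negP => /and3P[_ AV VB].
by rewrite -rowgS (subset_trans AV VB) in AB.
Qed.

(** E_v fixes the inclusion matrix of x-spaces in m-spaces: up to the constant [gb (m - x) (v - x)],
    which counts v-spaces in between, that matrix factors through the one for v-spaces, and E_v
    fixes the latter by B A = 1. *)
Lemma sum_Eker_sup x v m Y W' : Y \in Gr x -> W' \in Gr m ->
  (x <= v)%N -> (v <= m)%N -> (m <= n - m)%N ->
  \sum_(W in Gr m | Y \subset W) Eker v m W' W = (Y \subset W')%:R.
Proof.
move=> Yx W'm xv vm mn.
have c0 : gb (m - x) (v - x) != 0 by rewrite gbinom_neq0 //; lia.
apply: (mulfI c0); rewrite -(card_Gr_interval Yx W'm xv vm) mulr_sumr.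
transitivity (\sum_(W in Gr m | Y \subset W) \sum_(U in Gr v | U \subset W')
    gb (m - x) (v - x) * bker v m U W).
  by apply: eq_bigr => W _; rewrite -sum_bker_sub // mulr_sumr.
rewrite exchange_big /=.
transitivity (\sum_(U in Gr v | U \subset W') ((Y \subset U)%:R : algC)); last first.
  rewrite -natr_sum -big_mkcondr sum1dep_card; congr (_%:R); apply: eq_card => U.
  by rewrite /subsp_interval in_set [in RHS]in_set -andbA [(U \subset _) && _]andbC.
apply: eq_bigr => U /andP[Uv _]; rewrite big_mkcondr /=.
transitivity (\sum_(W in Gr m) \sum_(V in Gr v | (Y \subset V) && (V \subset W)) bker v m U W).
  apply: eq_bigr => W Wm; rewrite sumr_const.
  have := card_Gr_interval Yx Wm xv vm.
  rewrite (_ : #|subsp_interval v Y W| =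
    #|[pred V in Gr v | (Y \subset V) && (V \subset W)]|); last first.
    by apply: eq_card => V; rewrite [LHS]in_set.
  rewrite -[bker _ _ _ _ *+ _]mulr_natl => ->.
  by case: (Y \subset W); rewrite ?mulr1 ?mulr0 ?mul0r.
rewrite (exchange_big_dep (fun V => (V \in Gr v) && (Y \subset V))) /=; last first.
  by move=> W V _ /and3P[-> ->].
rewrite (eq_bigr (fun V => (U == V)%:R)) => [|V /andP[Vv YV]]; last first.
  rewrite -(bker_inverse Uv Vv vm mn); apply: eq_bigl => W.
  by rewrite Vv YV.
rewrite -natr_sum -big_mkcondr sum1dep_card; congr (_%:R).
have [YU|YU] := boolP (Y \subset U).
  rewrite (_ : [set V | _] = [set U]) ?cards1 //; apply/setP => V; rewrite [LHS]in_set [RHS]in_set1.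
  by rewrite [V == U]eq_sym; case: eqP => [<-|]; rewrite ?andbF // Uv YU.
rewrite (_ : [set V | _] = set0) ?cards0 //; apply/setP => V; rewrite [LHS]in_set [RHS]in_set0.
by case: eqP => [<-|]; rewrite ?andbF // (negbTE YU) andbF.
Qed.

(** With E_x = A B, the trace of E_x E_v is that of B (E_v A) = B A, the identity on x-spaces. *)
Lemma sum_Eker_prod_le x v m : (x <= v)%N -> (v <= m)%N -> (m <= n - m)%N ->
  \sum_(W in Gr m) \sum_(W' in Gr m) Eker x m W W' * Eker v m W' W = #|Gr x|%:R.
Proof.
move=> xv vm mn; have xm := leq_trans xv vm.
transitivity (\sum_(W in Gr m) \sum_(W' in Gr m) \sum_(Y in Gr x)
    if Y \subset W then bker x m Y W' * Eker v m W' W else 0).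
  apply: eq_bigr => W Wm; apply: eq_bigr => W' W'm.
  by rewrite -big_mkcondr -sum_bker_sub // mulr_suml.
rewrite exchange_big /=; under eq_bigr => W' _ do rewrite exchange_big /=.
transitivity (\sum_(W' in Gr m) \sum_(Y in Gr x) bker x m Y W' * (Y \subset W')%:R).
  apply: eq_bigr => W' W'm; apply: eq_bigr => Y Yx.
  by rewrite -big_mkcondr -mulr_sumr (sum_Eker_sup Yx W'm xv vm mn).
rewrite exchange_big -sumr_const; apply: eq_bigr => Y Yx /=.
transitivity ((Y == Y)%:R : algC); last by rewrite eqxx.
rewrite -(bker_inverse Yx Yx xm mn) [RHS]big_mkcondr; apply: eq_bigr => W _.
by case: (Y \subset W); rewrite ?mulr1 ?mulr0.
Qed.

Lemma sum_Eker_prod x v m : (x <= m)%N -> (v <= m)%N -> (m <= n - m)%N ->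
  \sum_(W in Gr m) \sum_(W' in Gr m) Eker x m W W' * Eker v m W W' = #|Gr (minn x v)|%:R.
Proof.
wlog xv : x v / (x <= v)%N.
  move=> th xm vm mn; have /orP[xv|vx] := leq_total x v; first exact: th.
  rewrite minnC -(th v x) //.
  by apply: eq_bigr => W _; apply: eq_bigr => W' _; rewrite mulrC.
move=> xm vm mn; rewrite (minn_idPl xv) -(sum_Eker_prod_le xv vm mn).
by apply: eq_bigr => W Wm; apply: eq_bigr => W' W'm; rewrite [Eker v _ _ _]Eker_sym.
Qed.

End Traces.

(** * Identification of P_0 + ... + P_x with E_x *)

Section ProjectionKernel.
Variables (F : finFieldType) (n : nat).
Implicit Types (A B : 'M[F]_n) (U W V : {set 'rV[F]_n}) (g h : 'M[F]_n).
Local Notation Gr := (subspaces F n).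
Local Notation GL := (GLset F n).
Local Notation q := (#|F|%:R : algC).
Local Notation gb := (gbinom q).
Hint Resolve cardF_gt1 : core.

(** The coefficient of |e_W'> in P_u |e_W>. *)
Definition pker (u : nat) W W' : algC :=
  dimV F n u / #|GL|%:R * \sum_(g in GL | actS g W == W') chi u g.

Lemma chi_conj u g h : h \in unitmx -> chi u (h *m g *m invmx h) = chi u g.
Proof. by move=> hU; rewrite /chi; case: u => [|u]; rewrite !permchar_conj. Qed.

Lemma pker_act u h W W' : h \in unitmx -> pker u (actS h W) (actS h W') = pker u W W'.
Proof.
move=> hU; rewrite /pker; congr (_ * _).
rewrite big_mkcondr [RHS]big_mkcondr /=.
have hV : invmx h \in unitmx by rewrite unitmx_inv.
rewrite (sum_GL_mull _ hV) (sum_GL_mulr _ hU); apply: eq_bigr => g _.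
rewrite actSM !mulmxA mulmxV // mul1mx -actSM (inj_eq (can_inj (actSK hU))).
by rewrite -(chi_conj u (invmx h *m g *m h) hU) !mulmxA mulmxV // mul1mx -mulmxA mulmxV // mulmx1.
Qed.

(** The multiplicity of V_u in the permutation representation on v-spaces, as a difference of two
    Burnside counts: min(u, v) - min(u - 1, v) is 1 if u <= v and 0 otherwise. *)
Lemma sum_chi_permchar u v : (u + v <= n)%N ->
  \sum_(g in GL) chi u g * permchar v g = #|GL|%:R * (u <= v)%N%:R.
Proof.
case: u => [|u] uvn.
  rewrite (eq_bigr (fun g => permchar 0 g * permchar v g)) => [|g _]; last by rewrite /chi subr0.
  by rewrite sum_permchar_prod // min0n muln1 mulr1.
rewrite (eq_bigr (fun g => permchar u.+1 g * permchar v g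
  - permchar u g * permchar v g)); last first.
  by move=> g _; rewrite /chi mulrBl.
rewrite sumrB !sum_permchar_prod //; last by lia.
rewrite !natrM -mulrBr; congr (_ * _).
have [uv|vu] := leqP u.+1 v.
  by rewrite (minn_idPl (ltnW uv)) -natrB // subSnn.
by rewrite (minn_idPr (vu : (v <= u)%N)) subrr.
Qed.

Lemma permchar1 d : permchar d (1%:M : 'M[F]_n) = #|Gr d|%:R.
Proof. by congr (_%:R); apply: eq_card => W; rewrite in_set actS1 eqxx andbT. Qed.

Lemma sum_dimV_le x v : \sum_(u < x.+1) dimV F n u * (u <= v)%N%:R = #|Gr (minn x v)|%:R.
Proof.
elim: x => [|x IH].
  by rewrite big_ord_recl big_ord0 min0n /dimV /chi mulr1 addr0 subr0 permchar1.
rewrite big_ord_recr /= IH /dimV /chi !permchar1.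
have [xv|vx] := leqP x.+1 v.
  by rewrite (minn_idPl (ltnW xv)) mulr1 addrC subrK.
by rewrite (minn_idPr (vx : (v <= x)%N)) mulr0 addr0.
Qed.

Lemma card_GL_neq0 : (#|GL|%:R : algC) != 0.
Proof.
rewrite pnatr_eq0 cards_eq0; apply/set0Pn; exists 1%:M.
by rewrite inE unitmx1.
Qed.

Lemma sum_pker_Eker u v m : (u <= m)%N -> (v <= m)%N -> (m <= n - m)%N ->
  \sum_(W in Gr m) \sum_(W' in Gr m) pker u W W' * Eker v m W W' =
  dimV F n u * (u <= v)%N%:R.
Proof.
move=> um vm mn.
transitivity (dimV F n u / #|GL|%:R * \sum_(g in GL) chi u g * permchar v g); last first.
  by rewrite sum_chi_permchar ?mulrA ?divfK ?card_GL_neq0 //; lia.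
rewrite mulr_sumr.
transitivity (\sum_(W in Gr m) \sum_(g in GL)
    dimV F n u / #|GL|%:R * (chi u g * Eker v m W (actS g W))).
  apply: eq_bigr => W Wm.
  transitivity (\sum_(W' in Gr m) \sum_(g in GL | actS g W == W')
      dimV F n u / #|GL|%:R * (chi u g * Eker v m W W')).
    by apply: eq_bigr => W' _; rewrite /pker -mulrA -mulr_sumr mulr_suml.
  rewrite (exchange_big_dep (mem GL)) /=; last by move=> W' g _ /andP[].
  apply: eq_bigr => g gU; rewrite (big_pred1 (actS g W)) // => W'.
  rewrite /= gU /= eq_sym; case: eqP => [->|]; rewrite ?andbF //.
  by rewrite actS_subspaces ?Wm //; move: gU; rewrite inE.
rewrite exchange_big; apply: eq_bigr => g gU /=.
rewrite -!mulr_sumr sum_Eker_act //; by move: gU; rewrite inE.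
Qed.

Lemma beta_neq0 x m r : (m <= n - r)%N -> beta F n x m r != 0.
Proof.
move=> mr; rewrite /beta; apply: mulf_neq0; last by rewrite invr_eq0 gbinom_neq0 //; lia.
apply: mulf_neq0; first by rewrite mulf_neq0 ?signr_eq0 ?expr_neq0.
by rewrite expf_neq0 // mulf_neq0 ?invr_eq0 ?expr_neq0 // -[q]expr1 expr_neq0.
Qed.

(* Triangularity of [Eker v m] in the functions [#|avoid r W W'|], which
   themselves are triangular in the dimension of the intersection. *)
Lemma kernel_eq0 m (H : {set 'rV[F]_n} -> {set 'rV[F]_n} -> algC) : (m <= n - m)%N ->
  (forall W W' V V', W \in Gr m -> W' \in Gr m -> V \in Gr m -> V' \in Gr m ->
     #|W :&: W'| = #|V :&: V'| -> H W W' = H V V') ->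
  (forall v, (v <= m)%N -> \sum_(W in Gr m) \sum_(W' in Gr m) H W W' * Eker v m W W' = 0) ->
  forall W W', W \in Gr m -> W' \in Gr m -> H W W' = 0.
Proof.
move=> mn Hinv HE.
pose G r : algC := \sum_(W in Gr m) \sum_(W' in Gr m) H W W' * #|avoid r W W'|%:R.
have HG v : \sum_(W in Gr m) \sum_(W' in Gr m) H W W' * Eker v m W W' =
    \sum_(r < v.+1) beta F n v m r * gb (m - r) (v - r) * G r.
  transitivity (\sum_(W in Gr m) \sum_(r < v.+1) \sum_(W' in Gr m)
      beta F n v m r * gb (m - r) (v - r) * (H W W' * #|avoid r W W'|%:R)).
    apply: eq_bigr => W _; rewrite exchange_big; apply: eq_bigr => W' _ /=.
    by rewrite mulr_sumr; apply: eq_bigr => r _; rewrite mulrCA.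
  rewrite exchange_big; apply: eq_bigr => r _ /=.
  by rewrite mulr_sumr; apply: eq_bigr => W _; rewrite mulr_sumr.
have G0 v : (v <= m)%N -> G v = 0.
  elim/ltn_ind: v => v IH vm; have := HE v vm; rewrite HG big_ord_recr /=.
  rewrite big1 ?add0r => [/eqP|r _]; last by rewrite IH ?mulr0 // (leq_trans (ltnW (ltn_ord r))).
  rewrite subnn gbinom0 mulr1 mulf_eq0 => /orP[|/eqP //].
  by rewrite (negPf (beta_neq0 _ _)) //; lia.
suff H0 d W W' : W \in Gr m -> W' \in Gr m -> #|W :&: W'| = (#|F| ^ d)%N -> H W W' = 0.
  move=> W W' Wm W'm; case/subspacesP: (Wm) => A _ eA; case/subspacesP: (W'm) => B _ eB.
  by apply: H0 Wm W'm _; rewrite eA eB -rowgI card_rowg.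
elim/ltn_ind: d W W' => d IH W W' Wm W'm cd.
have dm : (d <= m)%N.
  rewrite -(leq_exp2l _ _ (card_finNzRing_gt1 F)) -cd -(card_subspace Wm).
  exact: subset_leq_card (subsetIl _ _).
(* For [r = m - d], [avoid r V V'] is empty when the intersection has dimension above [d], and [H]
   vanishes below [d] by induction. So [G r] is the value of [H] at dimension [d] times a positive
   count. *)
have := G0 (m - d)%N (leq_subr _ _).
pose X V V' : nat := if #|V :&: V'| == (#|F| ^ d)%N then #|avoid (m - d) V V'| else 0%N.
have -> : G (m - d)%N = H W W' * (\sum_(V in Gr m) \sum_(V' in Gr m) X V V')%N%:R.
  rewrite natr_sum mulr_sumr; apply: eq_bigr => V Vm.
  rewrite natr_sum mulr_sumr; apply: eq_bigr => V' V'm; rewrite /X.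
  case: eqP => [ceq|]; first by rewrite (Hinv V V' W W') // ceq cd.
  case/subspacesP: (Vm) => A rA eA; case/subspacesP: (V'm) => B rB eB.
  have [lt_d _|] := ltnP (\rank (A :&: B)%MS) d.
    by rewrite (IH _ lt_d V V') ?mul0r ?mulr0 // eA eB -rowgI card_rowg.
  rewrite leq_eqVlt => /predU1P[->|lt_d _]; first by rewrite eA eB -rowgI card_rowg.
  rewrite eA eB card_avoid gbinom_small ?mulr0 //.
  have : (\rank (A :&: B)%MS <= \rank A)%N by rewrite mxrankS // capmxSl.
  by rewrite rA; lia.
move/eqP; rewrite mulf_eq0 => /orP[/eqP //|].
rewrite pnatr_eq0 sum_nat_eq0 => /forall_inP /(_ W Wm).
rewrite sum_nat_eq0 => /forall_inP /(_ W' W'm); rewrite /X cd eqxx.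
case/subspacesP: (Wm) (Wm) cd => A rA -> _; case/subspacesP: W'm => B rB ->.
rewrite -rowgI card_rowg => /eqP; rewrite eqn_exp2l ?card_finNzRing_gt1 // => /eqP rd.
rewrite -(eqr_nat algC) card_avoid rd rA mulf_eq0.
by rewrite (negPf (expr_neq0 _ _)) ?(negPf (gbinom_neq0 _ _)).
Qed.

(** [kernel_eq0] applies to the difference: both kernels are GL-invariant, and both pair with
    [Eker v m] to [#|Gr (minn x v)|]. *)
Lemma sum_pker x m W W' : (x <= m)%N -> (m <= n - m)%N -> W \in Gr m -> W' \in Gr m ->
  \sum_(u < x.+1) pker u W W' = Eker x m W W'.
Proof.
move=> xm mn Wm W'm; apply/eqP; rewrite -subr_eq0; apply/eqP.
pose H V V' : algC := \sum_(u < x.+1) pker u V V' - Eker x m V V'.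
apply: (@kernel_eq0 m H) => // [U U' V V' Um U'm Vm V'm c|v vm].
  have [g gU [<- <-]] := GL_pair_trans Um Vm U'm V'm c.
  rewrite /H; congr (_ - _); last first.
    by apply: Eker_inv; rewrite ?actS_subspaces // -actS_cap // card_actS.
  by apply: eq_bigr => u _; rewrite pker_act.
transitivity (\sum_(u < x.+1) \sum_(V in Gr m) \sum_(V' in Gr m) pker u V V' * Eker v m V V'
   - \sum_(V in Gr m) \sum_(V' in Gr m) Eker x m V V' * Eker v m V V').
  rewrite [X in _ = X - _]exchange_big -sumrB; apply: eq_bigr => V _ /=.
  rewrite [X in _ = X - _]exchange_big -sumrB; apply: eq_bigr => V' _ /=.
  by rewrite mulrBl mulr_suml.
rewrite sum_Eker_prod // -sum_dimV_le -sumrB big1 // => u _.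
by rewrite sum_pker_Eker ?subrr // (leq_trans _ xm) // -ltnS.
Qed.

(** Between spaces of equal dimension inclusion is equality, so A is the identity and A B = B A =
    1. *)
Lemma Eker_diag m W W' : (m <= n - m)%N -> W \in Gr m -> W' \in Gr m ->
  Eker m m W W' = (W == W')%:R.
Proof.
have sub_eq U V : U \in Gr m -> V \in Gr m -> U \subset V -> U = V.
  by move=> Um Vm UV; apply/eqP; rewrite eqEcard UV (card_subspace Um) (card_subspace Vm) leqnn.
move=> mn Wm W'm; rewrite -sum_bker_sub // -(bker_inverse Wm W'm _ mn) //.
rewrite (big_pred1 W) => [|U]; last first.
  by apply/andP/eqP => [[Um UW]|->]; [apply: sub_eq|split].
rewrite (big_pred1 W') // => U.
by apply/andP/eqP => [[Um UW]|->]; [apply/esym; apply: sub_eq|split].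
Qed.

End ProjectionKernel.

(** * From the quantum state to sums of kernels over the support of Xi *)

Section Probability.
Variables (F : finFieldType) (n : nat).
Implicit Types (A B : 'M[F]_n) (U W V : {set 'rV[F]_n}) (g h : 'M[F]_n).
Local Notation Gr := (subspaces F n).
Local Notation GL := (GLset F n).
Local Notation q := (#|F|%:R : algC).
Local Notation gb := (gbinom q).
Hint Resolve cardF_gt1 : core.

Definition lines_in W : {set {set 'rV[F]_n}} := [set l in Lines F n | l \subset W].

(** This makes the |e_W> orthonormal: a subspace is the union of its lines and 0. *)
Lemma lines_in_inj m W W' : W \in Gr m -> W' \in Gr m -> lines_in W = lines_in W' -> W = W'.
Proof.
have sub V V' : V \in Gr m -> V' \in Gr m -> lines_in V = lines_in V' -> V \subset V'.
  move=> Vm V'm eL; apply/subsetP => v vV.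
  have [->|v0] := eqVneq v 0; first exact: subspace0 V'm.
  have vL : rowg v \in lines_in V.
    rewrite inE; apply/andP; split; last first.
      by case/subspacesP: Vm vV => A _ ->; rewrite mem_rowg rowgS.
    rewrite inE; apply/existsP; exists v.
    by rewrite rank_rV v0 /=; apply/eqP.
  by move: vL; rewrite eL inE => /andP[_ /subsetP]; apply; rewrite mem_rowg.
by move=> Wm W'm eL; apply/eqP; rewrite eqEsubset !sub.
Qed.

Lemma actL_lines_in g W : g \in unitmx -> actL g (lines_in W) = lines_in (actS g W).
Proof.
move=> gU; apply/setP => L; apply/imsetP/idP => [[L0 /setIdP[L0L L0W] ->]|/setIdP[LL LW]].
  by apply/setIdP; rewrite /Lines actS_subspaces // actS_subset.
exists (actS (invmx g) L); last by rewrite actSKV.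
by apply/setIdP; rewrite /Lines actS_subspaces ?unitmx_inv // -(actS_subset _ _ gU) actSKV.
Qed.

Lemma braket_ket m g W W' : g \in GL -> W \in Gr m -> W' \in Gr m ->
  braket (ket W) (phi g (ket W')) = (actS g W' == W)%:R.
Proof.
rewrite inE => gU Wm W'm; rewrite /braket (bigD1 (lines_in W)) /=; last first.
  by rewrite powersetE; apply/subsetP => L; rewrite inE => /andP[].
rewrite big1 => [|S /andP[_ SW]]; last by rewrite /ket -/(lines_in W) (negPf SW) rmorph0 mul0r.
rewrite addr0 /phi /ket -!/(lines_in _) eqxx rmorph1 mul1r actL_lines_in ?unitmx_inv //.
congr (_%:R); congr nat_of_bool; apply/eqP/eqP => [/lines_in_inj e|<-]; last by rewrite actSK.
by rewrite -(e m) ?actSKV // actS_subspaces ?unitmx_inv.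
Qed.

Lemma pprobE u m k l : 0 <= qbinom q (n - k) (m - l) ->
  pprob F n u m k l = (qbinom q (n - k) (m - l))^-1 *
    \sum_(W in Wset F n m k l) \sum_(W' in Wset F n m k l) pker u W' W.
Proof.
move=> B0; have WGr W : W \in Wset F n m k l -> W \in Gr m by rewrite inE => /andP[].
set Ws := Wset F n m k l in WGr *.
(* Nonnegativity of the binomial makes its square root real, so conjugation fixes the
   normalization. *)
have cE : ((sqrtC (qbinom q (n - k) (m - l)))^-1)^* * (sqrtC (qbinom q (n - k) (m - l)))^-1 =
    (qbinom q (n - k) (m - l))^-1.
  by rewrite geC0_conj ?invr_ge0 ?sqrtC_ge0 // -invfM -expr2 sqrtCK.
rewrite -cE /pprob /braket /Xi -/Ws; move: (sqrtC _)^-1 => c in cE *.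
pose t g W W' S := c^* * (ket W S)^* * (dimV F n u / #|GL|%:R * (chi u g * (c * phi g (ket W') S))).
transitivity (\sum_(S in powerset (Lines F n)) \sum_(W in Ws)
  \sum_(g in GL) \sum_(W' in Ws) t g W W' S).
  apply: eq_bigr => S _; rewrite rmorphM rmorph_sum mulr_sumr mulr_suml.
  apply: eq_bigr => W _; rewrite /Proj mulr_sumr mulr_sumr; apply: eq_bigr => g _.
  by rewrite /phi !mulr_sumr.
rewrite exchange_big mulr_sumr; apply: eq_bigr => W WWs /=.
rewrite exchange_big /=.
under eq_bigr => g _ do rewrite exchange_big /=.
rewrite exchange_big mulr_sumr /=; apply: eq_bigr => W' W'Ws /=.
rewrite /pker big_mkcondr !mulr_sumr; apply: eq_bigr => g gU.
transitivity (c^* * c * (dimV F n u / #|GL|%:R) * chi u g * braket (ket W) (phi g (ket W'))).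
  by rewrite /braket mulr_sumr; apply: eq_bigr => S _; rewrite /t; ring.
rewrite (braket_ket gU (WGr _ WWs) (WGr _ W'Ws)) -!mulrA; do 3!congr (_ * _).
by case: eqP; rewrite ?mulr1 ?mulr0.
Qed.

(** * The support of Xi as the (m - l)-subspaces of a complementary space *)

Section Bijection.
Variables (CL CC : 'M[F]_n) (m l : nat).
Hypotheses (rL : \rank CL = l) (lm : (l <= m)%N) (LC : (CL :&: CC)%MS = 0).

Definition extend_by W := rowg (CL + rowg_mx W)%MS.

Lemma extend_by_rowg A : extend_by (rowg A) = rowg (CL + A)%MS.
Proof. by apply: eq_rowg; apply: adds_eqmx => //; apply: rowgK. Qed.

Lemma mxrank_add_sub A : (A <= CC)%MS -> \rank (CL + A)%MS = (l + \rank A)%N.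
Proof.
move=> AC; rewrite mxrank_disjoint_sum ?rL //; apply/eqP.
by rewrite -submx0 -LC capmxS.
Qed.

(** [W] is recovered from [W :&: CC]: it contains the direct sum of [CL] and [W :&: CC], of the same
    dimension [l + (m - l)]. Conversely [(CL + A) :&: CC] is [A] by the modular law. *)
Lemma sum_extend_by (T : nmodType) (f : {set 'rV[F]_n} -> T) :
  \sum_(W in [set W in Gr m | (rowg CL \subset W) && (W :&: rowg CC \in Gr (m - l))]) f W =
  \sum_(W in subsp_interval (m - l) [set 0] (rowg CC)) f (extend_by W).
Proof.
rewrite (reindex_onto extend_by (fun W => W :&: rowg CC)) => [|W /setIdP[/subspacesP[A rA ->]]].
  apply: eq_bigl => W; apply/andP/setIdP => [[/setIdP[_ /andP[_ +]] /eqP eW]|].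
    by rewrite eW => Wm; split=> //; rewrite sub1set (subspace0 Wm) -eW subsetIr.
  case=> /subspacesP[A rA ->] /andP[_]; rewrite rowgS extend_by_rowg => AC.
  have eA : ((CL + A) :&: CC :=: A)%MS.
    rewrite addsmxC; apply: eqmx_trans (eqmx_sym (matrix_modl _ AC)) _.
    by rewrite LC addsmx0_id.
  rewrite -rowgI (eq_rowg eA) eqxx; split=> //; apply/setIdP; rewrite !rowg_subspaces.
  rewrite mxrank_add_sub // rA subnKC // eqxx; split=> //.
  by rewrite rowgS addsmxSl -rowgI (eq_rowg eA) rowg_subspaces rA eqxx.
rewrite rowgS -rowgI rowg_subspaces extend_by_rowg => /andP[LA /eqP rAC].
apply: eq_rowg; apply/eqmxP; rewrite -(geq_leqif (mxrank_leqif_eq _)).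
  by rewrite mxrank_add_sub ?capmxSr // rAC rA subnKC.
by rewrite addsmx_sub LA capmxSl.
Qed.

Lemma card_avoid_extend_by r W W' :
  W \in subsp_interval (m - l) [set 0] (rowg CC) ->
  W' \in subsp_interval (m - l) [set 0] (rowg CC) ->
  #|avoid r (extend_by W) (extend_by W')|%:R = q ^+ (l * r) * #|avoid r W W'|%:R.
Proof.
move=> /setIdP[/subspacesP[A rA ->] /andP[_ +]] /setIdP[/subspacesP[B rB ->] /andP[_ +]].
rewrite !rowgS !extend_by_rowg => AC BC.
have rAB : \rank ((CL + A) :&: (CL + B))%MS = (l + \rank (A :&: B)%MS)%N.
  have := mxrank_sum_cap (CL + A)%MS (CL + B)%MS.
  have -> : \rank ((CL + A) + (CL + B))%MS = \rank (CL + (A + B))%MS.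
    by apply: eqmx_rank; rewrite !addsmx_sub !(addsmxSl, addsmxSr) /=;
      rewrite !(submx_trans _ (addsmxSr CL (A + B)%MS)) ?addsmxSl ?addsmxSr //=;
      rewrite (submx_trans (addsmxSr CL A) (addsmxSl _ _))
        (submx_trans (addsmxSr CL B) (addsmxSr _ _))
        (submx_trans (addsmxSl CL A) (addsmxSl _ _)).
  rewrite !mxrank_add_sub ?addsmx_sub ?AC //; have := mxrank_sum_cap A B.
  by lia.
by rewrite !card_avoid rAB mxrank_add_sub // subnDl mulnDl exprD mulrA.
Qed.

End Bijection.

Lemma coordV_rowg i : coordV F n i = rowg (pid_mx i : 'M[F]_n).
Proof.
have pidE (v : 'rV[F]_n) j : (v *m (pid_mx i : 'M[F]_n)) 0 j = if (j < i)%N then v 0 j else 0.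
  rewrite mxE (bigD1 j) //= mxE eqxx /= big1 ?addr0 => [|k kj].
    by rewrite mulr_natr mulrb.
  by rewrite mxE (inj_eq val_inj) (negPf kj) mulr0.
apply/setP => v; rewrite mem_rowg inE; apply/forallP/submxP => [v0|[D ->] j].
  exists v; apply/rowP => j; rewrite pidE; case: ltnP => // ij.
  by have := v0 j; rewrite ij => /eqP.
by apply/implyP => ij; rewrite pidE ltnNge ij.
Qed.

Lemma coordVc_rowg i : coordVc F n i = rowg (copid_mx i : 'M[F]_n).
Proof.
have copidE (v : 'rV[F]_n) j : (v *m (copid_mx i : 'M[F]_n)) 0 j = if (j < i)%N then 0 else v 0 j.
  rewrite mxE (bigD1 j) //= !mxE eqxx /= big1 ?addr0 => [|k kj].
    by rewrite eqxx mulrBr mulr1 mulr_natr mulrb /=; case: ifP; rewrite ?subrr ?subr0.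
  by rewrite !mxE (inj_eq val_inj) (negPf kj) subrr mulr0.
apply/setP => v; rewrite mem_rowg inE; apply/forallP/submxP => [v0|[D ->] j].
  exists v; apply/rowP => j; rewrite copidE; case: ltnP => // ji.
  by have := v0 j; rewrite ji => /eqP.
by apply/implyP => ji; rewrite copidE ji.
Qed.

Lemma pid_copid_cap l k : (l <= k)%N ->
  ((pid_mx l : 'M[F]_n) :&: (copid_mx k : 'M[F]_n))%MS = 0.
Proof.
move=> lk; apply/eqP; rewrite -mxrank_eq0 -rowg_triv -coordV_rowg -coordVc_rowg.
rewrite eqEsubset sub1set !inE; apply/andP; split; last first.
  by apply/andP; split; apply/forallP => j; apply/implyP => _; rewrite mxE.
apply/subsetP => v; rewrite !inE => /andP[/forallP v1 /forallP v2].
apply/eqP/rowP => j; rewrite [RHS]mxE; apply/eqP.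
have [jk|kj] := ltnP j k; first by have := v2 j; rewrite jk.
by have := v1 j; rewrite (leq_trans lk kj).
Qed.

(** [sum_avoid_sub] with top space [CC]: choose [R] in [CC] avoiding [W], then [W'] between [R] and
    [CC]. The guard [r <= d] matters, since [d - r] would truncate to 0 and the last factor would be
    1. *)
Lemma sum_avoid_below (CC : 'M[F]_n) d r W : W \in subsp_interval d [set 0] (rowg CC) ->
  \sum_(W' in subsp_interval d [set 0] (rowg CC)) (#|avoid r W' W|%:R : algC) =
  if (r <= d)%N then q ^+ (d * r) * gb (\rank CC - d) r * gb (\rank CC - r) (d - r) else 0.
Proof.
move=> /setIdP[/subspacesP[B rB ->] /andP[_ BC]].
have inY U : (U \in subsp_interval d [set 0] (rowg CC)) = (U \in Gr d) && (U \subset rowg CC).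
  by rewrite in_set sub1set; case: (boolP (U \in Gr d)) => // /subspace0 ->.
rewrite (eq_bigl _ _ inY); case: leqP => [rd|dr]; last first.
  apply: big1 => U /andP[/subspacesP[A rA ->] _].
  by rewrite card_avoid gbinom_small ?mulr0 // rA; lia.
rewrite -natr_sum sum_avoid_sub // natr_sum.
rewrite (eq_bigr (fun=> gb (\rank CC - r) (d - r))) =>
    [|R /setIdP[/subspacesP[A rA ->] /andP[AC _]]].
  rewrite sumr_const -[_ *+ _]mulr_natl card_avoid.
  suff -> : \rank (CC :&: B)%MS = d by [].
  by rewrite -rB; apply: eqmx_rank; rewrite capmxSr sub_capmx submx_refl andbT -rowgS.
by rewrite card_interval ?rA // -rowgS.
Qed.

Lemma qbinom_gt0 (N e : nat) : (e <= N)%N -> 0 < qbinom q N e.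
Proof.
move=> eN; rewrite -gbinom_qbinom //; apply: prodr_gt0 => i _.
by rewrite divr_gt0 // subr_gt0 ltr_eXn2l // (leq_trans (ltn_ord i)).
Qed.

(** * Evaluation of the partial sums *)

Section Amplitudes.
Variables (m k l : nat).
Hypotheses (mn : (m <= n)%N) (kn : (k <= n)%N) (mkl : (m + k - n <= l)%N).
Hypotheses (lmk : (l <= minn m k)%N) (mnm : (m <= n - m)%N).

Let CL : 'M[F]_n := pid_mx l.
Let CC : 'M[F]_n := copid_mx k.
Let Y := subsp_interval (m - l) [set 0] (rowg CC).

Let lm : (l <= m)%N. Proof. by lia. Qed.
Let lk : (l <= k)%N. Proof. by lia. Qed.
Let rL : \rank CL = l. Proof. by rewrite /CL rank_pid_mx //; lia. Qed.
Let rC : \rank CC = (n - k)%N. Proof. by rewrite /CC rank_copid_mx. Qed.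

Let WsetE : Wset F n m k l =
  [set W in Gr m | (rowg CL \subset W) && (W :&: rowg CC \in Gr (m - l))].
Proof. by rewrite /Wset coordV_rowg coordVc_rowg. Qed.

Let cardY : #|Y|%:R = gb (n - k) (m - l).
Proof.
by rewrite /Y -rowg_eq0 card_interval ?sub0mx ?mxrank0 // rC !subn0.
Qed.

Lemma card_Wset : #|Wset F n m k l|%:R = qbinom q (n - k) (m - l).
Proof.
rewrite -gbinom_qbinom //; last by lia.
rewrite -cardY -!sum1_card WsetE !natr_sum.
by rewrite (sum_extend_by rL lm (pid_copid_cap lk) (fun=> 1%:R)).
Qed.

Lemma sum_pprob x : (x <= m)%N ->
  \sum_(u < x.+1) pprob F n u m k l = (qbinom q (n - k) (m - l))^-1 *
    \sum_(W in Wset F n m k l) \sum_(W' in Wset F n m k l) Eker x m W' W.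
Proof.
move=> xm; have B0 : 0 <= qbinom q (n - k) (m - l) by rewrite ltW // qbinom_gt0 //; lia.
rewrite (eq_bigr _ (fun (u : 'I_x.+1) _ => pprobE u B0)) -mulr_sumr; congr (_ * _).
rewrite exchange_big; apply: eq_bigr => W /setIdP[Wm _] /=.
rewrite exchange_big; apply: eq_bigr => W' /setIdP[W'm _] /=.
exact: sum_pker.
Qed.

Lemma sum_pprob_all : \sum_(u < m.+1) pprob F n u m k l = 1.
Proof.
rewrite sum_pprob // (eq_bigr (fun=> 1)) => [|W WW].
  by rewrite sumr_const card_Wset mulVf // gt_eqF // qbinom_gt0 //; lia.
rewrite (bigD1 W) //= Eker_diag ?eqxx ?(proj1 (setIdP WW)) //.
rewrite big1 ?addr0 // => W' /andP[/setIdP[W'm _] W'W].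
by rewrite Eker_diag ?(negPf W'W) ?(proj1 (setIdP WW)).
Qed.

Lemma sum_pprob_gbinom x : (x <= m)%N ->
  \sum_(u < x.+1) pprob F n u m k l =
  \sum_(r < x.+1) (-1) ^+ r * q ^+ 'C(r, 2) * q ^+ r
    * (gb (m - r) (x - r) / gb (n - x - r) (m - x))
    * (if (r <= m - l)%N then gb (n - k - (m - l)) r * gb (n - k - r) (m - l - r) else 0).
Proof.
move=> xm; rewrite sum_pprob // WsetE.
rewrite (sum_extend_by rL lm (pid_copid_cap lk)).
under eq_bigr => W _ do rewrite (sum_extend_by rL lm (pid_copid_cap lk)).
rewrite -/CC -/Y.
transitivity ((qbinom q (n - k) (m - l))^-1 * \sum_(W in Y) \sum_(r < x.+1)
   beta F n x m r * gb (m - r) (x - r) * (q ^+ (l * r) *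
   \sum_(W' in Y) (#|avoid r W' W|%:R : algC))).
  congr (_ * _); apply: eq_bigr => W WY; rewrite exchange_big; apply: eq_bigr => r _ /=.
  rewrite !mulr_sumr; apply: eq_bigr => W' W'Y.
  by rewrite (card_avoid_extend_by rL lm (pid_copid_cap lk)).
rewrite exchange_big mulr_sumr; apply: eq_bigr => r _ /=.
rewrite (eq_bigr (fun=> beta F n x m r * gb (m - r) (x - r) * (q ^+ (l * r) *
  (if (r <= m - l)%N then q ^+ ((m - l) * r) * gb (\rank CC - (m - l)) r
    * gb (\rank CC - r) (m - l - r) else 0)))) => [|W WY]; last by rewrite sum_avoid_below.
rewrite sumr_const -[X in _ * X = _]mulr_natl cardY gbinom_qbinom //; last by lia.
rewrite mulKf; last by rewrite gt_eqF // qbinom_gt0 //; lia.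
rewrite rC; case: ifP => _; last by rewrite !mulr0.
(* The power [q ^+ (l * r)] from adding [CL] completes this one to [q ^+ (m * r)], which cancels the
   power of [q ^+ m] in [beta]. *)
have -> : q ^+ ((m - l) * r) = q ^+ (m * r) / q ^+ (l * r).
  have -> : (m * r = (m - l) * r + l * r)%N by rewrite -mulnDl subnK.
  by rewrite exprD mulfK ?expr_neq0.
rewrite /beta expr_div_n -exprM; field.
by rewrite !expr_neq0 // gbinom_neq0 //; have := ltn_ord r; lia.
Qed.

End Amplitudes.

End Probability.

(** * Rewriting the summands as terms of the 4phi3 *)

Lemma qpoch_expN (q : algC) (a r : nat) : 1 < q ->
  qpoch (q ^- a) q r = if (r <= a)%N
    then (-1) ^+ r * q ^+ 'C(r, 2) / q ^+ (a * r) * (qpoch q q a / qpoch q q (a - r)) else 0.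
Proof.
move=> q1; have qa0 : q ^+ a != 0 by rewrite expr_neq0.
have -> : qpoch (q ^- a) q r = (\prod_(j < r) (q ^+ a - q ^+ j)) / q ^+ (a * r).
  rewrite exprM -[in X in _ / _ ^+ X](card_ord r) -prodr_const -prodfV -big_split.
  by apply: eq_bigr => j _ /=; rewrite mulrBl mulfV // mulrC.
case: leqP => [ra|ar]; last by rewrite (bigD1 (Ordinal ar)) //= subrr !mul0r.
rewrite -[\prod_(j < r) _](mulfK (qpochqq_neq0 q1 (a - r))) qpoch_shift //.
by field; rewrite qpochqq_neq0 // expr_neq0.
Qed.

(* With [m], [n - m] and [M + N] in the denominator, the powers of [q] and all
   but one sign of the reversed Pochhammer symbols cancel. *)
Lemma phi43_term (q : algC) (n m x M N r : nat) : 1 < q ->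
  (x <= m)%N -> (m <= n - m)%N -> (r <= x)%N ->
  (-1) ^+ r * q ^+ 'C(r, 2) * q ^+ r
    * (gbinom q (m - r) (x - r) / gbinom q (n - x - r) (m - x))
    * (if (r <= M)%N then gbinom q N r * gbinom q (M + N - r) (M - r) else 0) =
  qbinom q (M + N) M * qbinom q n x / qbinom q n m *
  ((qpoch (q ^- x) q r * qpoch (q ^+ x / q ^+ n) q r * qpoch (q ^- M) q r * qpoch (q ^- N) q r)
   / (qpoch (q ^- m) q r * qpoch (q ^+ m / q ^+ n) q r * qpoch (q ^- (M + N)) q r * qpoch q q r)
   * q ^+ r).
Proof.
move=> q1 xm mn rx.
have expNB a : (a <= n)%N -> q ^+ a / q ^+ n = q ^- (n - a).
  move=> an; rewrite -{1}(subnK an) exprD invfM mulrCA mulfV ?mulr1 //.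
  exact: expr_neq0.
rewrite !expNB ?qpoch_expN //; try lia.
(* If [r] exceeds [M] or [N] both sides vanish: on the right a Pochhammer symbol of the numerator,
   on the left the guard or [gbinom q N r]. *)
case: (leqP r M) => rM; last by rewrite !(mulr0, mul0r).
case: (leqP r N) => rN; last by rewrite (@gbinom_small q N r) ?(mulr0, mul0r).
have [-> -> -> ->] : [/\ (r <= x), (r <= n - x), (r <= m) & (r <= n - m)]%N by split; lia.
rewrite (leq_trans rM (leq_addr _ _)) !gbinom_qbinom //; try lia.
rewrite /qbinom.
have -> : (m - r - (x - r) = m - x)%N by lia.
have -> : (n - x - r - (m - x) = n - m - r)%N by lia.
have -> : (M + N - r - (M - r) = N)%N by lia.
have -> : (M + N - M = N)%N by lia.
have -> : q ^+ (x * r) = q ^+ (m * r) / q ^+ ((m - x) * r).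
  have -> : (m * r = x * r + (m - x) * r)%N by rewrite -mulnDl subnKC.
  by rewrite exprD mulfK ?expr_neq0.
have -> : q ^+ ((n - x) * r) = q ^+ ((n - m) * r) * q ^+ ((m - x) * r).
  by rewrite -exprD -mulnDl; congr (_ ^+ (_ * _)); lia.
have -> : q ^+ ((M + N) * r) = q ^+ (M * r) * q ^+ (N * r) by rewrite mulnDl exprD.
have D0 a := qpochqq_neq0 q1 a; have E0 a := expr_neq0 q1 a.
have s0 : (-1) ^+ r != 0 :> algC by rewrite signr_eq0.
by field; rewrite !D0 !E0 s0.
Qed.

Theorem theoremC6 (F : finFieldType) (n m k l : nat) :
  (m <= n)%N -> (k <= n)%N -> (m + k - n <= l)%N -> (l <= minn m k)%N ->
  (m <= n - m)%N ->
  let q : algC := #|F|%:R in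
  let M := (m - l)%N in
  let N := (n + l - m - k)%N in
  (forall x : nat, (x <= m)%N ->
     \sum_(u < x.+1) pprob F n u m k l
     = qbinom q (n - k) M * qbinom q n x / qbinom q n m *
       phi43 (q ^- x) (q ^+ x / q ^+ n) (q ^- M) (q ^- N)
             (q ^- m) (q ^+ m / q ^+ n) (q ^- (M + N)) q q x)
  /\ \sum_(u < m.+1) pprob F n u m k l = 1.
Proof.
move=> mn kn mkl lmk mnm q M N; split; last exact: sum_pprob_all.
(* The subtractions in [N] do not truncate, because [m + k - n <= l]. *)
have eMN : (M + N = n - k)%N by lia.
move=> x xm; rewrite sum_pprob_gbinom // /phi43 mulr_sumr; apply: eq_bigr => r _.
have -> : (n - k - (m - l) = N)%N by lia.
by rewrite -eMN phi43_term ?cardF_gt1 // -ltnS.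
Qed.
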